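(* Let $n,k\ge1$. On $k$-Dyck paths of size $n$, the evacuation is congruent to $\delta^{-k}\circ\mathrm{Rvac}$ up to the matching map, i.e. $$\mathrm{ev}=\mathrm{Mat}\circ\delta^{-k}\circ\mathrm{Rvac}\circ\mathrm{Mat}^{-1}.$$
   Context: A $k$-Dyck path of size $n$ is a lattice path from $(0,0)$ to $(kn,n)$ with steps $U=(0,1)$, $R=(1,0)$, weakly above $y=x/k$, identified with its word of length $N=(k+1)n$. Products of maps are compositions, rightmost factor first; empty products are the identity. Evacuation: the toggle $t_i$ ($1\le i\le N-1$) exchanges the $i$-th and $(i+1)$-st letters if the result is a $k$-Dyck path and otherwise fixes the path; $\mathrm{ev}=t_1(t_2t_1)\cdots(t_{N-1}\cdots t_2t_1)$. Rowmotion and rowvacuation: consider the poset of unit boxes above the lowest path $(UR^k)^n$ and below the top path $U^nR^{kn}$, where a box is larger the further up and/or to the left it is (covers: the box immediately above and the box immediately to the left). The rank of the top-left box is $r=(n-1)k-1$, and the rank drops by one when moving one box down or one box to the right. A $k$-Dyck path $p$ corresponds to the order filter $F(p)$ of boxes above $p$. For $0\le i\le r$, the rank toggle $\mathbf t_i$ is the product over all boxes $c$ of rank $i$ of the (commuting) filter toggles at $c$, where the filter toggle at $c$ adds $c$ to the filter if $c$ is not in it and the result is an order filter, removes $c$ if $c$ is in it and the result is an order filter, and does nothing otherwise. Then $\delta=\mathbf t_0\mathbf t_1\cdots\mathbf t_r$ (equivalently, $\delta$ sends a filter $F$ to the complement of the order ideal generated by the minimal elements of $F$) and $\mathrm{Rvac}=(\mathbf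 t_r)(\mathbf t_{r-1}\mathbf t_r)\cdots(\mathbf t_1\cdots\mathbf t_r)(\mathbf t_0\mathbf t_1\cdots\mathbf t_r)$. Matching map $\mathrm{Mat}$: write $\bar i=N+1-i$ for $1\le i\le n$ (''barred integers''). Number the rows of $p$ by $1,\dots,n$ from the top. Set $k_i=kn-j+1$ if the up step in the $i$-th row is immediately preceded by a right step, lying in the $j$-th column from the left; otherwise $k_i=\bar i$. Starting with $I=[1,N]$, for $i=1,\dots,n$ let $S_i$ be the set of $k+1$ successive elements of $I$ starting from $k_i$, taken in decreasing order if $k_i$ is unbarred and in increasing order if $k_i$ is barred (cyclically, integers modulo $N$), and replace $I$ by $I\setminus S_i$. $\mathrm{Mat}(p)$ is the $k$-Dyck path whose up steps are at positions $\min S_1,\dots,\min S_n$. It is a bijection. *)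

(* Defs.v *)
From HB Require Import structures.
From mathcomp Require Import all_boot.

Set Implicit Arguments.
Unset Strict Implicit.
Unset Printing Implicit Defensive.

(* Product of self-maps, rightmost factor applied first: *)
(* prodmap [:: f1; ...; fm] = f1 \o ... \o fm.           *)
Definition prodmap (T : Type) (fs : seq (T -> T)) : T -> T :=
  foldr (fun f g => f \o g) id fs.

Lemma prodmap_map_inj (T : Type) (I : Type) (F : I -> T -> T) (s : seq I) :
  (forall i, injective (F i)) -> injective (prodmap [seq F i | i <- s]).
Proof. by move=> FI; elim: s => [|i s IH] //=; apply: inj_comp. Qed.

Notation U := true (only parsing).
Notation R := false (only parsing).

Definition is_dyck (n k : nat) (w : (k.+1 * n).-tuple bool) : bool :=
  (count_mem U w == n) &&
  [forall m : 'I_(k.+1 * n).+1,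
     count_mem R (take m w) <= k * count_mem U (take m w)].

Record dyck (n k : nat) : predArgType := Dyck {
  dyck_word :> (k.+1 * n).-tuple bool;
  _ : is_dyck dyck_word
}.
HB.instance Definition _ n k := [isSub for @dyck_word n k].
HB.instance Definition _ n k := [Finite of dyck n k by <:].

(* Positions in a word are numbered from 1. *)
Definition word_of_ups (N : nat) (s : seq nat) : N.-tuple bool :=
  [tuple of [seq j \in s | j <- iota 1 N]].

Definition ups (w : seq bool) : seq nat :=
  [seq j <- iota 1 (size w) | nth R w j.-1].

(* Rows are numbered from the top and, unlike positions, from 0. *)
Definition up_pos (w : seq bool) (i : nat) : nat := nth 0 (rev (ups w)) i.

(* The number of boxes to the left of the path in row i; if the up step of *)
(* that row is preceded by a right step, this is the column (from 1) of    *)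
(* that right step.                                                        *)
Definition rights_before (w : seq bool) (i : nat) : nat :=
  count_mem R (take (up_pos w i).-1 w).

Definition swap_letters (N i : nat) (w : N.-tuple bool) : N.-tuple bool :=
  [tuple nth R w (if j.+1 == i then i else if j == i :> nat then i.-1 else j)
   | j < N].

Definition path_toggle (n k i : nat) (p : dyck n k) : dyck n k :=
  insubd p (swap_letters i p).

Definition ev (n k : nat) : dyck n k -> dyck n k :=
  prodmap [seq prodmap [seq @path_toggle n k i | i <- rev (iota 1 j)]
          | j <- iota 1 (k.+1 * n).-1].

(* A box is a pair (row from the top, column from the left), both from 0. *)
(* In row i the lowest path (U R^k)^n goes up along x = k * (n - 1 - i).  *)
Record box (n k : nat) : predArgType := Box {
  box_coord :> 'I_n * 'I_(k * n);
  _ : box_coord.2 < k * (n - box_coord.1.+1)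
}.
HB.instance Definition _ n k := [isSub for @box_coord n k].
HB.instance Definition _ n k := [Finite of box n k by <:].

Definition box_le (n k : nat) (c d : box n k) : bool :=
  (d.1 <= c.1) && (d.2 <= c.2).

(* The subtractions are exact: every box has c.1 + c.2 <= (n - 1) k - 1. *)
Definition box_rank (n k : nat) (c : box n k) : nat :=
  n.-1 * k - 1 - (c.1 + c.2).

Definition is_filter (n k : nat) (A : {set box n k}) : bool :=
  [forall c, forall d, (c \in A) && box_le c d ==> (d \in A)].

Record filter_of (n k : nat) : predArgType := Filter {
  filter_set :> {set box n k};
  _ : is_filter filter_set
}.
HB.instance Definition _ n k := [isSub for @filter_set n k].
HB.instance Definition _ n k := [Finite of filter_of n k by <:].

Definition filter_toggle (n k : nat) (c : box n k) (A : filter_of n k) :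
    filter_of n k :=
  insubd A (if c \in (A : {set _}) then A :\ c else c |: A).

(* The toggles at the boxes of a given rank commute, so the order in which *)
(* they are enumerated does not matter.                                    *)
Definition rank_toggle (n k i : nat) : filter_of n k -> filter_of n k :=
  prodmap [seq filter_toggle c | c <- enum [pred c : box n k | box_rank c == i]].

(* The ranks are 0, ..., r = (n - 1) k - 1, i.e. iota 0 (n.-1 * k). *)
Definition filter_rowmotion (n k : nat) : filter_of n k -> filter_of n k :=
  prodmap [seq @rank_toggle n k i | i <- iota 0 (n.-1 * k)].

Definition filter_rowvacuation (n k : nat) : filter_of n k -> filter_of n k :=
  prodmap [seq prodmap [seq @rank_toggle n k i | i <- iota a (n.-1 * k - a)]
          | a <- rev (iota 0 (n.-1 * k))].

Definition above (n k : nat) (w : seq bool) : {set box n k} :=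
  [set c : box n k | c.2 < rights_before w c.1].

Definition row_length (n k : nat) (A : {set box n k}) (i : nat) : nat :=
  #|[set c in A | c.1 == i :> nat]|.

(* Before the up step of row i come row_length A i right steps and the up *)
(* steps of the n - 1 - i rows below.                                     *)
Definition boundary_ups (n k : nat) (A : {set box n k}) : seq nat :=
  rev [seq row_length A i + (n - i) | i <- iota 0 n].

Lemma ups_sorted w : sorted ltn (ups w).
Proof. by rewrite sorted_filter ?iota_ltn_sorted //; exact: ltn_trans. Qed.

Lemma nth_ups w j : j.+1 \in ups w = nth R w j.
Proof.
rewrite mem_filter mem_iota /= add1n ltnS.
by case: (ltnP j (size w)) => [|le]; rewrite ?andbT // andbF nth_default.
Qed.

Lemma ups_range w j : j \in ups w -> 0 < j <= size w.
Proof. by rewrite mem_filter mem_iota add1n ltnS => /andP[]. Qed.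

Lemma ups_word N s : sorted ltn s -> {in s, forall j, 0 < j <= N} ->
  ups (word_of_ups N s) = s.
Proof.
move=> ss sN; apply: (irr_sorted_eq ltn_trans ltnn) => // [|j].
  exact: ups_sorted.
case: j => [|j].
  apply/idP/idP => [/ups_range //|/sN //].
rewrite nth_ups; case: (ltnP j N) => jN.
  by rewrite (nth_map 0) ?size_iota // nth_iota // add1n.
rewrite nth_default ?size_tuple //; apply/esym/negP => /sN /andP[_].
by rewrite ltnNge jN.
Qed.

Lemma count_R_U (w : seq bool) : count_mem R w = size w - count_mem U w.
Proof.
have -> : count_mem R w = count (predC (pred1 U)) w.
  by apply: eq_count; case.
by rewrite -(count_predC (pred1 U) w) addKn.
Qed.

Lemma count_take_word N s m : uniq s -> {in s, forall j, 0 < j} -> m <= N ->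
  count_mem U (take m (word_of_ups N s)) = count (leq^~ m) s.
Proof.
move=> us s0 mN; rewrite /= -map_take take_iota (minn_idPl mN) count_map.
rewrite -!size_filter; apply/perm_size/uniq_perm; rewrite ?filter_uniq //.
  exact: iota_uniq.
move=> j; rewrite !mem_filter mem_iota /= add1n ltnS.
have [js|] := boolP (j \in s); last by rewrite andbF.
by rewrite (s0 _ js) !andbT.
Qed.

Lemma word_of_ups_dyck n k (s : seq nat) :
  uniq s -> {in s, forall j, 0 < j <= k.+1 * n} -> size s = n ->
  (forall m, m <= k.+1 * n -> m <= k.+1 * count (leq^~ m) s) ->
  is_dyck (word_of_ups (k.+1 * n) s).
Proof.
move=> us sN sn sm; set N := (k.+1 * n) in sN sm *.
have s0 : {in s, forall j, 0 < j} by move=> j /sN /andP[].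
apply/andP; split.
  have -> : count_mem U (word_of_ups N s) =
            count_mem U (take N (word_of_ups N s)).
    by rewrite take_oversize // size_tuple.
  rewrite count_take_word //; apply/eqP; rewrite -[RHS]sn; apply/eqP.
  by rewrite -all_count; apply/allP => j /sN /andP[].
apply/forallP => -[m /=]; rewrite ltnS => mN.
rewrite count_R_U count_take_word // size_take size_tuple.
rewrite (_ : (if m < N then m else N) = m); last first.
  by case: ltnP => // Nm; apply/eqP; rewrite eqn_leq mN Nm.
by rewrite leq_subLR -mulSn; exact: sm.
Qed.

Lemma size_ups w : size (ups w) = count_mem U w.
Proof.
rewrite size_filter (iotaDl 1 0) count_map -[in RHS](mkseq_nth R w) count_map.
by apply: eq_count => j /=; case: nth.
Qed.

Lemma size_ups_dyck n k (p : dyck n k) : size (ups p) = n.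
Proof. by case: p => w /= /andP[/eqP]; rewrite size_ups. Qed.

Lemma above_filter n k (p : dyck n k) : is_filter (above n k p).
Proof.
have sz := size_ups_dyck p.
apply/forallP => c; apply/forallP => d; apply/implyP => /andP[].
rewrite !inE => cp /andP[dc1 dc2]; apply: leq_ltn_trans dc2 _.
apply: leq_trans cp _; rewrite /rights_before.
have le : up_pos p c.1 <= up_pos p d.1.
  rewrite /up_pos !nth_rev ?sz // leq_eqVlt; apply/orP.
  move: dc1; rewrite leq_eqVlt => /orP[/eqP ->|dc]; first by left.
  right; apply: (sorted_ltn_nth ltn_trans) => //; rewrite ?inE ?sz.
  - exact: ups_sorted.
  - by rewrite ltn_subrL /= (leq_ltn_trans _ (ltn_ord c.1)).
  - by rewrite ltn_subrL /= (leq_ltn_trans _ (ltn_ord c.1)).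
  - by apply: ltn_sub2l => //; rewrite (leq_ltn_trans dc).
have le' : (up_pos p c.1).-1 <= (up_pos p d.1).-1 by rewrite -!subn1 leq_sub2r.
rewrite -[take (up_pos p d.1).-1 p](cat_take_drop (up_pos p c.1).-1).
by rewrite take_takel // count_cat leq_addr.
Qed.

Definition filter_of_path (n k : nat) (p : dyck n k) : filter_of n k :=
  Filter (above_filter p).

Section RowLength.
Variables (n k : nat) (A : {set box n k}).
Hypothesis filterA : is_filter A.

Let cols i := [seq c.2 : nat | c : box n k <- enum [set c in A | c.1 == i :> nat]].

Let size_cols i : size (cols i) = row_length A i.
Proof. by rewrite size_map -cardE. Qed.

Let mem_cols i x :
  reflect (exists2 c, c \in A & c.1 = i :> nat /\ c.2 = x :> nat) (x \in cols i).
Proof.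
apply: (iffP mapP) => [[c]|[c cA [ci cx]]].
  by rewrite mem_enum inE => /andP[cA /eqP ci] ->; exists c.
by exists c; rewrite // mem_enum inE cA ci eqxx.
Qed.

Let uniq_cols i : uniq (cols i).
Proof.
rewrite map_inj_in_uniq ?enum_uniq // => c d; rewrite !mem_enum !inE.
move=> /andP[_ /eqP ci] /andP[_ /eqP di] cd; apply: val_inj.
case: c d ci di cd => [[c1 c2] ?] [[d1 d2] ?] /= ci di cd.
by congr pair; apply: val_inj; rewrite //= ci di.
Qed.

Let up_left i j x y : j <= i -> y <= x -> x \in cols i -> y \in cols j.
Proof.
move=> ji yx /mem_cols[c cA [ci cx]].
have jn : j < n by rewrite (leq_ltn_trans ji) // -ci.
have yN : y < k * n by rewrite (leq_ltn_trans yx) // -cx.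
have cP : c.2 < k * (n - c.1.+1) by case: (c).
have dP : y < k * (n - j.+1).
  rewrite (leq_ltn_trans yx) // -cx (leq_trans cP) // leq_mul2l leq_sub2l ?orbT //.
  by rewrite ltnS ci.
pose d := @Box n k (Ordinal jn, Ordinal yN) dP.
apply/mem_cols; exists d => //.
move/forallP: filterA => /(_ c)/forallP/(_ d)/implyP; apply.
by rewrite cA /box_le /= ci cx ji.
Qed.

Let cols_ltn i x : (x \in cols i) = (x < row_length A i).
Proof.
apply/idP/idP => [xi|].
  rewrite -(size_iota 0 x.+1) -size_cols; apply: uniq_leq_size (iota_uniq _ _) _.
  by move=> y; rewrite mem_iota /= add0n ltnS => yx; apply: up_left xi.
apply: contraTT => xi; rewrite -leqNgt -(size_iota 0 x) -size_cols.
apply: uniq_leq_size (uniq_cols i) _ => y yi; rewrite mem_iota /= add0n ltnNge.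
by apply: contraNN xi => xy; apply: up_left yi.
Qed.

Lemma mem_row_length (c : box n k) : (c \in A) = (c.2 < row_length A c.1).
Proof.
rewrite -cols_ltn; apply/idP/mem_cols => [cA|[d dA [d1 d2]]]; first by exists c.
suff -> : c = d by [].
apply: val_inj; case: c d {dA} d1 d2 => [[c1 c2] ?] [[d1 d2] ?] /= e1 e2.
by congr pair; apply: val_inj.
Qed.

Lemma row_length_mono i j : i <= j -> row_length A j <= row_length A i.
Proof.
move=> ij; rewrite leqNgt; apply/negP; rewrite -cols_ltn => /(up_left ij (leqnn _)).
by rewrite cols_ltn ltnn.
Qed.

Lemma row_length_bound i : row_length A i <= k * (n - i.+1).
Proof.
rewrite leqNgt; apply/negP; rewrite -cols_ltn => /mem_cols[c _ [ci cx]].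
by case: c ci cx => [[c1 c2] /= cP] ci cx; move: cP; rewrite cx ci ltnn.
Qed.

Lemma size_boundary_ups : size (boundary_ups A) = n.
Proof. by rewrite size_rev size_map size_iota. Qed.

Lemma nth_boundary_ups i : i < n ->
  nth 0 (rev (boundary_ups A)) i = row_length A i + (n - i).
Proof. by move=> ni; rewrite revK (nth_map 0) ?size_iota // nth_iota. Qed.

Lemma boundary_ups_sorted : sorted ltn (boundary_ups A).
Proof.
rewrite rev_sorted; apply/(sortedP 0) => i; rewrite size_map size_iota => ni.
rewrite !(nth_map 0) ?size_iota ?nth_iota // ?(ltnW ni) // !add0n.
rewrite /= -addnS leq_add ?row_length_mono //.
by apply: ltn_sub2l => //; exact: ltnW.
Qed.

Lemma boundary_ups_le b : b < n -> nth 0 (boundary_ups A) b <= (k.+1 * b).+1.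
Proof.
move=> bn; rewrite /boundary_ups nth_rev ?size_map size_iota //.
have lt : n - b.+1 < n by rewrite ltn_subrL /= (leq_ltn_trans _ bn).
rewrite (nth_map 0) ?size_iota // nth_iota // add0n subKn //.
rewrite addnS ltnS mulSn addnC leq_add2l.
apply: leq_trans (row_length_bound _) _.
by rewrite -subSn // subSS subKn // ltnW.
Qed.

Lemma boundary_ups_range : {in boundary_ups A, forall j, 0 < j <= k.+1 * n}.
Proof.
move=> j; rewrite mem_rev => /mapP[i]; rewrite mem_iota /= add0n => ni ->.
rewrite addn_gt0 subn_gt0 ni orbT /= mulSn addnC leq_add ?leq_subr //.
by rewrite (leq_trans (row_length_bound _)) // leq_mul2l leq_subr orbT.
Qed.

Lemma boundary_dyck : is_dyck (word_of_ups (k.+1 * n) (boundary_ups A)).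
Proof.
have srt := boundary_ups_sorted; have sz := size_boundary_ups.
apply: word_of_ups_dyck => //; first exact: (sorted_uniq ltn_trans ltnn).
  exact: boundary_ups_range.
move=> m mN; set s := boundary_ups A in srt sz *; set c := count _ s.
have := count_size (leq^~ m) s; rewrite -/c sz leq_eqVlt => /orP[/eqP -> //|cn].
have sc : m < nth 0 s c.
  rewrite ltnNge; apply/negP => sm.
  have : count (leq^~ m) (take c.+1 s) <= c.
    by rewrite -[X in _ <= X]/(count _ s) -[in X in _ <= X](cat_take_drop c.+1 s)
       count_cat leq_addr.
  have -> : count (leq^~ m) (take c.+1 s) = size (take c.+1 s).
    apply/eqP; rewrite -all_count; apply/(all_nthP 0) => i.
    rewrite size_takel ?sz // => ic; rewrite nth_take //=.
    apply: leq_trans sm.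
    by rewrite (sorted_leq_nth leq_trans leqnn) ?inE ?sz //;
       [apply: sub_sorted srt => x y /ltnW | exact: leq_ltn_trans cn].
  by rewrite size_takel ?sz // ltnn.
by rewrite -ltnS (leq_trans sc) // boundary_ups_le.
Qed.

End RowLength.

Lemma filterP n k (A : filter_of n k) : is_filter A.
Proof. by case: A. Qed.

Definition path_of_filter (n k : nat) (A : filter_of n k) : dyck n k :=
  Dyck (boundary_dyck (filterP A)).

Lemma count_lt_nth_sorted s b :
  sorted ltn s -> b < size s -> 0 < nth 0 s b ->
  count (leq^~ (nth 0 s b).-1) s = b.
Proof.
move=> ss bs sb0; set P := leq^~ _.
have -> : count P s = count P (take b s) + count P (drop b s).
  by rewrite -count_cat cat_take_drop.
rewrite {}/P; have -> : count (leq^~ (nth 0 s b).-1) (take b s) = b.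
  rewrite -[RHS](size_takel (ltnW bs)); apply/eqP; rewrite -all_count.
  apply/(all_nthP 0) => i; rewrite size_takel ?(ltnW bs) // => ib.
  rewrite nth_take // -ltnS prednK //.
  by apply: (sorted_ltn_nth ltn_trans) => //; rewrite inE // (ltn_trans ib).
apply/eqP; rewrite -[X in _ == X]addn0 eqn_add2l -leqn0 leqNgt -has_count.
apply/hasPn => x /(nthP 0)[i]; rewrite size_drop ltn_subRL nth_drop => ib <-.
rewrite /= -ltnNge prednK //.
have sl : sorted leq s by apply: sub_sorted ss => x' y /ltnW.
by apply: (sorted_leq_nth leq_trans leqnn) => //; rewrite ?inE ?leq_addr.
Qed.

Lemma word_ups (n k : nat) (p : dyck n k) :
  word_of_ups (k.+1 * n) (ups p) = p.
Proof.
apply: val_inj; apply: (@eq_from_nth _ R); rewrite !size_tuple // => j jN.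
by rewrite (nth_map 0) ?size_iota // nth_iota // add1n nth_ups.
Qed.

Lemma up_pos_range n k (p : dyck n k) i : i < n -> 0 < up_pos p i <= k.+1 * n.
Proof.
move=> ni; have := @ups_range p (up_pos p i); rewrite size_tuple; apply.
by rewrite -mem_rev mem_nth // size_rev size_ups_dyck.
Qed.

Lemma ups_before n k (p : dyck n k) i : i < n ->
  count_mem U (take (up_pos p i).-1 p) = n - i.+1.
Proof.
move=> ni; have sz := size_ups_dyck p; have ss := ups_sorted p.
have /andP[p0 pN] := up_pos_range p ni.
set q := _.-1.
have -> : take q p = take q (word_of_ups (k.+1 * n) (ups p)) by rewrite word_ups.
rewrite {}/q count_take_word.
- move: p0; rewrite /up_pos nth_rev ?sz // => p0.
  by rewrite count_lt_nth_sorted // sz ltn_subrL (leq_ltn_trans _ ni).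
- exact: (sorted_uniq ltn_trans ltnn).
- by move=> j /ups_range/andP[].
- by rewrite (leq_trans (leq_pred _)).
Qed.

Lemma up_posE n k (p : dyck n k) i : i < n ->
  up_pos p i = rights_before p i + (n - i).
Proof.
move=> ni; have /andP[p0 pN] := up_pos_range p ni.
have le : n - i.+1 <= (up_pos p i).-1.
  by rewrite -(ups_before p ni) (leq_trans (count_size _ _)) // size_take_min geq_minl.
rewrite /rights_before count_R_U ups_before // size_takel ?size_tuple; last first.
  by rewrite (leq_trans (leq_pred _)).
by rewrite -[n - i]prednK ?subn_gt0 // -subnS addnS subnK // prednK.
Qed.

Lemma rights_before_le n k (p : dyck n k) i : i < n ->
  rights_before p i <= k * (n - i.+1).
Proof.
move=> ni; rewrite -(ups_before p ni); have /andP[p0 pN] := up_pos_range p ni.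
have lt : (up_pos p i).-1 < (k.+1 * n).+1.
  by rewrite ltnS (leq_trans (leq_pred _)).
have : is_dyck p by case: (p).
by move=> /andP[_ /forallP /(_ (Ordinal lt))].
Qed.

Lemma path_of_filterK n k : cancel (@path_of_filter n k) (@filter_of_path n k).
Proof.
move=> A; apply: val_inj; apply/setP => c; rewrite !inE /=.
have fA := filterP A; rewrite mem_row_length //; congr (_ < _).
have cn := ltn_ord c.1.
have := up_posE (path_of_filter A) cn; rewrite /up_pos /= ups_word.
- by rewrite nth_boundary_ups // => /addIn.
- exact: boundary_ups_sorted.
- exact: boundary_ups_range.
Qed.

Lemma filter_of_pathK n k : cancel (@filter_of_path n k) (@path_of_filter n k).
Proof.
apply: inj_can_sym (@path_of_filterK n k) _ => p q pq.
have le i (p1 p2 : dyck n k) : filter_of_path p1 = filter_of_path p2 ->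
    i < n -> rights_before p1 i <= rights_before p2 i.
  move=> p12 ni; rewrite leqNgt; apply/negP => lt.
  have cP : rights_before p2 i < k * (n - i.+1).
    exact: leq_trans lt (rights_before_le p1 ni).
  have cN : rights_before p2 i < k * n.
    by rewrite (leq_trans cP) // leq_mul2l leq_subr orbT.
  have : @Box n k (Ordinal ni, Ordinal cN) cP \in filter_set (filter_of_path p2).
    by rewrite -p12 inE.
  by rewrite inE /= ltnn.
have upE : rev (ups p) = rev (ups q).
  apply: (@eq_from_nth _ 0); rewrite !size_rev !size_ups_dyck // => i ni.
  rewrite -/(up_pos p i) -/(up_pos q i) !up_posE //; congr (_ + _).
  by apply/eqP; rewrite eqn_leq !le.
apply: val_inj; rewrite /= -(word_ups p) -(word_ups q).
by rewrite -[ups p]revK upE revK.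
Qed.

Definition on_filters (n k : nat) (phi : filter_of n k -> filter_of n k) :
    dyck n k -> dyck n k :=
  @path_of_filter n k \o phi \o @filter_of_path n k.

Definition rowmotion (n k : nat) : dyck n k -> dyck n k :=
  on_filters (@filter_rowmotion n k).

Definition rowvacuation (n k : nat) : dyck n k -> dyck n k :=
  on_filters (@filter_rowvacuation n k).

Lemma filter_toggleK n k (c : box n k) : involutive (filter_toggle c).
Proof.
move=> A; apply: val_inj; rewrite /filter_toggle /insubd.
case: (insubP _ (if c \in (A : {set _}) then A :\ c else c |: A)) => [B _ BE|nA] /=.
  have -> : (if c \in (B : {set _}) then B :\ c else c |: B) = val A.
    rewrite [filter_set B]BE; case: (boolP (c \in filter_set A)) => cA.
      by rewrite setD11 setD1K.
    by rewrite setU11 setU1K.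
  by rewrite valK.
by rewrite insubN.
Qed.

(* Hence finv (@rowmotion n k) is a genuine inverse. *)
Lemma rowmotion_inj n k : injective (@rowmotion n k).
Proof.
apply: inj_comp (can_inj (@filter_of_pathK n k)).
apply: inj_comp (can_inj (@path_of_filterK n k)) _.
apply: prodmap_map_inj => i; apply: prodmap_map_inj => c.
exact: inv_inj (@filter_toggleK n k c).
Qed.

(* The boolean tells whether k_i is barred. *)
Definition mat_key (n k : nat) (w : seq bool) (i : nat) : bool * nat :=
  let q := up_pos w i in
  if (1 < q) && (nth U w (q - 2) == R)
  then (false, k * n - rights_before w i + 1)
  else (true, k.+1 * n - i).

(* The increasing list I, or its reverse, is rotated so as to start at k_i. *)
Definition mat_block (n k : nat) (w : seq bool) (i : nat) (I : seq nat) :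
    seq nat :=
  let: (barred, a) := mat_key n k w i in
  let J := if barred then I else rev I in
  take k.+1 (rot (index a J) J).

Fixpoint mat_blocks (n k : nat) (w : seq bool) (rows I : seq nat) :
    seq (seq nat) :=
  if rows is i :: rows' then
    let S := mat_block n k w i I in
    S :: mat_blocks n k w rows' [seq x <- I | x \notin S]
  else [::].

Definition mat_mins (n k : nat) (w : seq bool) : seq nat :=
  [seq \big[minn/k.+1 * n]_(x <- blk) x
  | blk <- mat_blocks n k w (iota 0 n) (iota 1 (k.+1 * n))].

Lemma mat_blocksP n k w rows I : uniq I -> size I = k.+1 * size rows ->
  let B := mat_blocks n k w rows I in
  [/\ size B = size rows, {in B, forall S, size S = k.+1}
    & perm_eq (flatten B) I].
Proof.
elim: rows I => [|i rows IH] I uI sI /=.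
  by split=> //; move: sI; rewrite muln0 => /size0nil ->.
set S := mat_block n k w i I.
have [J JI SE] : exists2 J, perm_eq J I & S = take k.+1 J.
  rewrite /S /mat_block; case: mat_key => b a.
  exists (rot (index a (if b then I else rev I)) (if b then I else rev I)) => //.
  by rewrite perm_rot; case: b; rewrite // perm_rev.
have sS : size S = k.+1.
  by rewrite SE size_takel // (perm_size JI) sI mulnS leq_addr.
have uJ : uniq J by rewrite (perm_uniq JI).
have IS : perm_eq [seq x <- I | x \notin S] (drop k.+1 J).
  rewrite -(permPl (perm_filter _ JI)).
  rewrite -{1}(cat_take_drop k.+1 J) filter_cat -SE.
  have -> : [seq x <- S | x \notin S] = [::].
    by apply/eqP; rewrite -[_ == _]negbK -has_filter; apply/hasPn => x ->.
  rewrite (_ : filter _ _ = drop k.+1 J) //; apply/all_filterP/allP => x xJ.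
  apply: contraTN uJ => xS; rewrite -(cat_take_drop k.+1 J) cat_uniq -SE.
  by rewrite [has _ _](_ : _ = true) ?andbF //; apply/hasP; exists x.
have [||sB BS pB] := IH [seq x <- I | x \notin S].
- exact: filter_uniq.
- by rewrite (perm_size IS) size_drop (perm_size JI) sI mulnS addKn.
split; first by rewrite /= sB.
- by move=> T; rewrite inE => /orP[/eqP -> //|]; exact: BS.
rewrite -(permPr JI) -(cat_take_drop k.+1 J) -SE perm_cat2l.
exact: perm_trans pB IS.
Qed.

Lemma min_mem m (S : seq nat) : 0 < size S -> {in S, forall x, x <= m} ->
  \big[minn/m]_(x <- S) x \in S.
Proof.
elim: S => // x [|y S] IH _ Sm.
  by rewrite big_cons big_nil inE; apply/eqP/minn_idPl/Sm/mem_head.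
rewrite big_cons; set z := \big[_/_]_(_ <- _) _; have zS : z \in y :: S.
  by apply: IH => // t tS; apply: Sm; rewrite inE tS orbT.
by rewrite /minn; case: ifP => _; rewrite inE ?eqxx // zS orbT.
Qed.

Lemma mat_dyck n k (w : seq bool) : is_dyck (word_of_ups (k.+1 * n) (mat_mins n k w)).
Proof.
have [||] := @mat_blocksP n k w (iota 0 n) (iota 1 (k.+1 * n)).
- exact: iota_uniq.
- by rewrite !size_iota.
rewrite /mat_mins; set B := mat_blocks _ _ _ _ _; set N := k.+1 * n.
rewrite size_iota => sB BS pB.
have BN S x : S \in B -> x \in S -> 0 < x <= N.
  move=> SB xS; have : x \in flatten B by apply/flattenP; exists S.
  by rewrite (perm_mem pB) mem_iota add1n ltnS.
have minS S : S \in B -> \big[minn/N]_(x <- S) x \in S.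
  by move=> SB; apply: min_mem => [|x /(BN _ _ SB)/andP[]//]; rewrite BS.
have uB : uniq (flatten B) by rewrite (perm_uniq pB) iota_uniq.
apply: word_of_ups_dyck.
- elim: B {sB pB BS BN} minS uB => //= S B IH minS.
  rewrite cat_uniq => /and3P[_ /hasPn SB uB]; rewrite IH // ?andbT; last first.
    by move=> T TB; apply: minS; rewrite inE TB orbT.
  apply/negP => /mapP[T TB E].
  have /SB/negP[] : \big[minn/N]_(x <- T) x \in flatten B.
    by apply/flattenP; exists T => //; apply: minS; rewrite inE TB orbT.
  by rewrite -E minS // mem_head.
- by move=> _ /mapP[S SB ->]; apply: (BN S) => //; exact: minS.
- by rewrite size_map.
move=> m mN; rewrite count_map -size_filter.
set C := [seq T <- B | _].
have <- : size (flatten C) = k.+1 * size C.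
  have : {in C, forall S, size S = k.+1}.
    by move=> S; rewrite mem_filter => /andP[_ /BS].
  elim: (C) => [|S D IH] DS; first by rewrite muln0.
  rewrite /= size_cat IH ?mulnS; last by move=> T TD; rewrite DS // inE TD orbT.
  by rewrite DS // mem_head.
rewrite -(size_iota 1 m); apply: uniq_leq_size (iota_uniq _ _) _ => x.
rewrite mem_iota add1n ltnS => /andP[x0 xm].
have : x \in flatten B by rewrite (perm_mem pB) mem_iota x0 add1n ltnS (leq_trans xm).
move=> /flattenP[S SB xS]; apply/flattenP; exists S => //.
rewrite mem_filter SB andbT /=; apply: leq_trans xm.
elim: S xS {SB} => // y S IH; rewrite inE big_cons => /orP[/eqP ->|/IH le].
  exact: geq_minl.
by rewrite geq_min le orbT.
Qed.

(* Injectivity of Mat is not shown here, but ev is a bijection, so that an   *)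
(* identity ev =1 Mat \o phi can only hold if Mat is onto, hence bijective. *)
Definition Mat (n k : nat) (p : dyck n k) : dyck n k := Dyck (mat_dyck n k p).

(* Main.v *)
Require Import Defs.
From mathcomp Require Import all_boot.
From mathcomp Require Import zify.

Set Implicit Arguments.
Unset Strict Implicit.
Unset Printing Implicit Defensive.

(** Put N = (k+1)n. A k-Dyck path encodes a noncrossing partition of Z/N into
    n blocks of size k+1, whose minima are the positions of the up steps.
    The only data needed about a partition are the numbers g a L of blocks
    that meet the cyclic window [a, a+L).  They satisfy an exchange rule: for
    the four windows obtained from one window by adding its left neighbour, its
    right neighbour, both or none, inclusion-exclusion is exact unless one block
    contains both neighbours and misses the window; in that case the blocks
    meeting the window are contained in it, so its length is k+1 times their
    number ([count_square]).  The toggles behind evacuation, rowmotion and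
    rowvacuation all follow this rule.

    Evacuation.  A path toggle only alters the number of up steps among the
    first i letters.  If this number is g s i and its neighbours are
    g (s+1) (i-1) and g s (i+1), the toggle replaces it by g (s+1) i: when
    inclusion-exclusion is exact this is the exchanged word, and in the
    exceptional case the exchanged word leaves the Dyck region
    ([toggle_window]).  Each promotion thus advances s by one, and the evacuated
    path has g (N-m) m up steps among its first m letters, which is the count
    for the reflected partition x |-> N-1-x ([ev_window], [ev_reflect]).

    Rowmotion and rowvacuation.  To counts h associate the filter of the boxes
    (i, j), numbered from 0, such that h i (n+j-i) <= n-1-i, and say that the
    box is at time t when i is replaced by i+t in the first argument.  A filter
    toggle at a box advances its time by one, again by the exchange rule
    ([toggle_advance]).  So rowmotion rotates the partition by one step, while
    rowvacuation brings every box to time rank + 1.  If h counts the reflected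
    partition, the window of a box at time rank + 1 is the mirror image of its
    window at time k in the original partition.  Hence rowvacuation sends the
    filter of the reflected partition to the k-th rowmotion iterate of the
    filter of the original one ([reflect_rowvacuation]).

    Matching.  The path whose filter comes from the counts of the reflected
    partition is sent by Mat back to the partition: before step i, the blocks
    not yet removed are those meeting the interval that ends at the barred
    integer of row i and starts at position kn minus the length of that row
    (counting from 0), and the noncrossing condition makes the next k+1
    remaining elements a whole block ([mem_mat_block], [Mat_labels]).  Since every Dyck path comes from a noncrossing partition
    ([dyck_label_noncrossing]), Mat is onto, hence bijective, and following the
    partition, its reflection and k rotations through the three descriptions
    gives the theorem. *)

(** * Noncrossing labellings and the windows they meet *)

(** A partition of Z/N is encoded by an N-periodic labelling of nat, two
    positions being in the same block when their labels agree.  Periodicity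
    lets a cyclic window be an ordinary interval. *)
Record noncrossing (n k : nat) (b : nat -> nat) : Prop := Noncrossing {
  label_periodic : forall x, b (x + k.+1 * n) = b x;
  label_size : forall a x,
    count_mem (b x) [seq b y | y <- iota a (k.+1 * n)] = k.+1;
  label_nocross : forall w x y z, w < x -> x < y -> y < z -> z < w + k.+1 * n ->
    b w = b y -> b x = b z -> b w = b x
}.

Definition labels (b : nat -> nat) (a L : nat) : seq nat :=
  [seq b x | x <- iota a L].

Definition label_count (b : nat -> nat) (a L : nat) : nat :=
  size (undup (labels b a L)).

(** What the toggles use of the block counts.  In [count_square] the second
    alternative is the case of a block that contains both end points of the
    large window and misses its interior. *)
Record window_count (n k : nat) (g : nat -> nat -> nat) : Prop := WindowCount {
  count0 : forall a, g a 0 = 0;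
  count_full : forall a, g a (k.+1 * n) = n;
  count_stepr : forall a L, g a L <= g a L.+1 <= (g a L).+1;
  count_stepl : forall a L, g a.+1 L <= g a L.+1 <= (g a.+1 L).+1;
  count_cover : forall a L, L <= k.+1 * n -> L <= k.+1 * g a L;
  count_square : forall a L, L.+2 <= k.+1 * n ->
    g a L.+1 + g a.+1 L.+1 = g a L.+2 + g a.+1 L \/
    [/\ g a L.+1 = (g a.+1 L).+1, g a.+1 L.+1 = (g a.+1 L).+1,
        g a L.+2 = (g a.+1 L).+1 & L = k.+1 * g a.+1 L]
}.

Lemma sum_count_undup (T : eqType) (s : seq T) :
  \sum_(x <- undup s) count_mem x s = size s.
Proof.
rewrite -[RHS](perm_size (perm_count_undup s)) size_flatten /shape -map_comp.
by rewrite sumnE big_map; apply: eq_bigr => x _ /=; rewrite size_nseq.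
Qed.

Lemma labels_rcons b a L : labels b a L.+1 = rcons (labels b a L) (b (a + L)).
Proof. by rewrite /labels -addn1 iotaD map_cat cats1. Qed.

Lemma labelsP b a L l :
  reflect (exists2 x, a <= x < a + L & b x = l) (l \in labels b a L).
Proof.
apply: (iffP mapP) => [[x]|[x xL <-]]; first by rewrite mem_iota => ? ->; exists x.
by exists x; rewrite ?mem_iota.
Qed.

Lemma label_count_cons b a L :
  label_count b a L.+1 = (b a \notin labels b a.+1 L) + label_count b a.+1 L.
Proof. by rewrite /label_count /labels /=; case: (_ \in _). Qed.

Lemma label_count_rcons b a L :
  label_count b a L.+1 = (b (a + L) \notin labels b a L) + label_count b a L.
Proof.
rewrite /label_count labels_rcons.
rewrite (perm_size (@perm_undup _ _ (b (a + L) :: labels b a L) _)).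
  by rewrite /=; case: (_ \in _).
by move=> x; rewrite mem_rcons.
Qed.

Section LabelCount.
Variables (n k : nat) (b : nat -> nat).
Hypothesis nc : noncrossing n k b.
Let N := k.+1 * n.

(** Counting the positions of a window label by label gives [count_full] and
    [count_cover].  In the exceptional case of [count_square], a block meeting
    the interior cannot leave it without crossing the block through the two end
    points, so the interior is a union of blocks. *)
Lemma label_count_window : window_count n k (label_count b).
Proof.
have small a L : L <= N ->
    forall l, l \in labels b a L -> count_mem l (labels b a L) <= k.+1.
  move=> LN _ /labelsP[x _ <-]; rewrite -(label_size nc a x) -/N.
  by rewrite -(subnKC LN) iotaD map_cat count_cat leq_addr.
have sumL a L : \sum_(l <- undup (labels b a L)) count_mem l (labels b a L) = L.
  by rewrite sum_count_undup size_map size_iota.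
have sumc a L : (\sum_(l <- undup (labels b a L)) k.+1) = k.+1 * label_count b a L.
  by rewrite big_const_seq count_predT iter_addn_0.
split=> //.
- move=> a; have := sumL a N.
  rewrite (eq_big_seq (fun=> k.+1)) => [|l].
    by rewrite sumc => /eqP; rewrite eqn_pmul2l // => /eqP.
  by rewrite mem_undup => /labelsP[x _ <-]; exact: label_size.
- by move=> a L; rewrite label_count_rcons; case: (_ \notin _) => /=; lia.
- by move=> a L; rewrite label_count_cons; case: (_ \notin _) => /=; lia.
- move=> a L LN; rewrite -{1}(sumL a L) -sumc.
  rewrite big_seq [X in _ <= X]big_seq; apply: leq_sum => l.
  by rewrite mem_undup; exact: small.
move=> a L LN; rewrite (label_count_cons b a L.+1) (label_count_cons b a L).
rewrite (label_count_rcons b a.+1 L) labels_rcons mem_rcons inE.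
set e := a.+1 + L; have [be|] := eqVneq (b a) (b e); last first.
  by left; case: (_ \in _); case: (_ \in _) => /=; lia.
case: (boolP (b a \in labels b a.+1 L)) => /= [|ba]; first by left; lia.
right; rewrite -be ba; split; try lia.
rewrite -sumc -[LHS](sumL a.+1); apply: eq_big_seq => l.
rewrite mem_undup => lM; have /labelsP[x xM xl] := lM.
rewrite -(label_size nc a x) xl -/N.
(* A full period starting at a consists of a, the interior and the rest. *)
set r := N - L.+2; have -> : N = (L + r.+1).+1.
  by rewrite /r; move: LN; rewrite -/N; lia.
rewrite /= -/(labels b a.+1 _) {2}/labels iotaD map_cat count_cat -/e.
have -> : (b a == l) = false by apply: contraNF ba => /eqP ->.
have lr : l \notin [seq b y | y <- iota e r.+1].
  apply: contra ba => /labelsP[z zr zl].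
  have [ez|ez] := eqVneq z e; first by rewrite be -ez zl.
  have <- // : l = b a.
  rewrite -xl; apply/esym.
  have eE : e = (a + L).+1 by rewrite /e.
  have rE : r = N - L.+2 by [].
  move: LN; rewrite -/N => LN.
  by apply: (@label_nocross _ _ _ nc a x e z); rewrite -/N ?zl //; lia.
by move/count_memPn: lr => ->; rewrite addn0.
Qed.

End LabelCount.

(** * Reflection of a labelling *)

Lemma labels_period n k b : (forall x, b (x + k.+1 * n) = b x) ->
  forall a, perm_eq (labels b a (k.+1 * n)) (labels b 0 (k.+1 * n)).
Proof.
move=> bN; elim=> [|a IH] //; apply: perm_trans IH; rewrite perm_sym.
move: bN; set N := k.+1 * n; case: N => // N bN.
rewrite [X in perm_eq _ X]labels_rcons addSnnS bN perm_sym perm_rcons.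
exact: perm_refl.
Qed.

Lemma period_mul N (b : nat -> nat) : (forall x, b (x + N) = b x) ->
  forall q x, b (x + q * N) = b x.
Proof.
move=> bN; elim=> [|q IH] x; first by rewrite addn0.
by rewrite mulSn addnA IH bN.
Qed.

Definition reflect_label (N : nat) (b : nat -> nat) (x : nat) : nat :=
  b (N.-1 - x %% N).

Section Reflect.
Variables (n k : nat) (b : nat -> nat).
Hypothesis nc : noncrossing n k b.
Let N := k.+1 * n.
Let b' := reflect_label N b.

(** The reflection is x |-> -1 - x modulo N; taking a large multiple of N
    keeps it within nat. *)
Lemma reflect_labelE q x : x < q * N -> b' x = b (q * N - x.+1).
Proof.
move=> xq; have N0 : 0 < N by case: (N) xq; rewrite ?muln0.
have bM := period_mul (label_periodic nc); rewrite -/N in bM.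
have qx : x %/ N < q by rewrite ltn_divLR.
rewrite /b' /reflect_label -(bM (q - (x %/ N).+1)); congr (b _).
have xr := ltn_pmod x N0; rewrite {3}(divn_eq x N) mulnBl mulSn.
have : (x %/ N).+1 * N <= q * N by rewrite leq_mul2r qx orbT.
by rewrite mulSn; lia.
Qed.

Lemma reflect_labels q a L : a + L <= q * N ->
  labels b' a L = rev (labels b (q * N - (a + L)) L).
Proof.
elim: L a => [|L IH] a aL //.
rewrite [in RHS]labels_rcons rev_rcons {1}/labels /= -/(labels _ _ _).
rewrite (@reflect_labelE q); last by lia.
congr (b _ :: _); first by lia.
by rewrite IH; [congr (rev (labels _ _ _)) |]; lia.
Qed.

Lemma reflect_count q a L : a + L <= q * N ->
  label_count b' a L = label_count b (q * N - (a + L)) L.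
Proof.
move=> aL; rewrite /label_count (reflect_labels aL).
by apply/perm_size/perm_undup => x; rewrite mem_rev.
Qed.

Lemma reflect_noncrossing : noncrossing n k b'.
Proof.
have [N0|N0] := posnP N.
  split; rewrite -/N N0 => //.
  - by move=> x; rewrite addn0.
  - by have := label_size nc 0 0; rewrite -/N N0.
  - by move=> *; lia.
have big x : x < x.+1 * N by rewrite leq_pmulr.
have b'N x : b' (x + N) = b' x by rewrite /b' /reflect_label modnDr.
split=> // [a x|w x y z wx xy yz zw]; rewrite -/N.
  rewrite -/(labels b' a N) (permP (labels_period b'N a)).
  rewrite (@reflect_labels 1) ?mul1n //.
  by rewrite subnn count_rev (reflect_labelE (big x)) label_size.
set q := z.+1; have zq := big z; rewrite -/q in zq.
rewrite !(@reflect_labelE q); try lia.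
move=> wy xz; rewrite xz wy.
by apply/esym/(label_nocross nc _ _ _ _ (esym xz) (esym wy)); rewrite -/N; lia.
Qed.

End Reflect.

(** * The noncrossing labelling of a Dyck path *)

Section DyckLabel.
Variables (n k : nat) (p : dyck n k).
Let N := k.+1 * n.

Definition ups_upto (w : seq bool) (m : nat) : nat := count_mem true (take m w).

Lemma ups_upto0 w : ups_upto w 0 = 0. Proof. by rewrite /ups_upto take0. Qed.

Lemma ups_uptoS w m : ups_upto w m.+1 = ups_upto w m + nth false w m.
Proof.
rewrite /ups_upto; have [mw|wm] := ltnP m (size w).
  by rewrite (take_nth false mw) -cats1 count_cat /= addn0; case: nth.
by rewrite !take_oversize ?nth_default ?addn0 // ltnW.
Qed.

Lemma ups_upto_cover m : m <= N -> m <= k.+1 * ups_upto p m.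
Proof.
move=> mN; have : is_dyck p by case: (p).
have mN' : m < N.+1 by [].
move=> /andP[_ /forallP /(_ (Ordinal mN'))]; rewrite count_R_U /=.
by rewrite size_takel ?size_tuple // -/(ups_upto p m) leq_subLR -mulSn.
Qed.

Lemma ups_upto_all : ups_upto p N = n.
Proof.
have : is_dyck p by case: (p).
by move=> /andP[/eqP + _]; rewrite /ups_upto take_oversize ?size_tuple.
Qed.

Let up x := nth false p x.
Definition height (w : seq bool) m := k.+1 * ups_upto w m - m.
Let ht := height p.

Let htS_up x : x < N -> up x -> ht x.+1 = ht x + k.
Proof.
move=> xN ux; have := @ups_upto_cover x (ltnW xN).
by rewrite /ht /height ups_uptoS -/(up x) ux mulnDr; lia.
Qed.

Let htS_right x : x < N -> ~~ up x -> ht x = (ht x.+1).+1.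
Proof.
move=> xN ux; have := @ups_upto_cover x.+1 xN.
by rewrite /ht /height ups_uptoS -/(up x) (negbTE ux); lia.
Qed.

(** The up step that opens the block of the letter at position x: the last one
    that starts no higher than the letter ends. *)
Definition opener (w : seq bool) (x : nat) : nat :=
  \max_(u < x.+1 | nth false w u && (height w u <= height w x.+1)) u.
Let lab := opener p.

Let lab_max u x : u <= x -> up u -> ht u <= ht x.+1 -> u <= lab x.
Proof.
move=> ux pu hu; have ux' : u < x.+1 by [].
by apply: (@leq_bigmax_cond _ _ _ (Ordinal ux')); rewrite /= -/(up u) pu.
Qed.

Let lab_spec x : x < N -> [/\ lab x <= x, up (lab x) & ht (lab x) <= ht x.+1].
Proof.
move=> xN; pose P (u : 'I_x.+1) := nth false p u && (height p u <= height p x.+1).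
have P0 : P ord0.
  have := @ups_upto_cover 1 (leq_ltn_trans (leq0n x) xN).
  rewrite /P /height /= ups_upto0 muln0 ups_uptoS ups_upto0.
  by case: (nth false p 0); rewrite ?muln0.
have c0 : 0 < #|P| by apply/card_gt0P; exists ord0.
have [u Pu] := eq_bigmax_cond (fun u : 'I_x.+1 => u : nat) c0.
rewrite -[\max_(_ in _) _]/(lab x) => ->; case/andP: (Pu) => pu hu.
by split=> //; rewrite -ltnS.
Qed.

(** Right steps descend by one, so to get above a height the path has to take
    an up step that starts at or below it. *)
Let ascent s t : s <= t -> t <= N -> ht s < ht t ->
  exists v, [/\ s <= v, v < t, up v & ht v <= ht s].
Proof.
elim: t => [|t IH]; first by rewrite leqn0 => /eqP ->; rewrite ltnn.
rewrite leq_eqVlt => /orP[/eqP -> |]; first by rewrite ltnn.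
rewrite ltnS => st tN h; have [lt|le] := ltnP (ht s) (ht t).
  by have [v [? ? ? ?]] := IH st (ltnW tN) lt; exists v; split=> //; apply: ltnW.
exists t; split=> //; apply: contraLR h => ut; rewrite -leqNgt.
by apply: leq_trans le; rewrite (htS_right tN ut).
Qed.

Let lab_up x : x < N -> up x -> lab x = x.
Proof.
move=> xN ux; have [le _ _] := lab_spec xN; apply/eqP; rewrite eqn_leq le /=.
by apply: lab_max => //; rewrite htS_up // leq_addr.
Qed.

(** Blocks are nested like brackets: between the opening of a block and one of
    its letters, no block opened earlier can have a letter.  Otherwise the path
    would have dropped below the opening height and climbed back, and the
    climbing up step would be a later opener. *)
Let lab_nest x y : y < N -> lab y <= x -> x <= y -> lab y <= lab x.
Proof.
move=> yN yx xy; have [_ uy hy] := lab_spec yN; apply: lab_max => //.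
rewrite leqNgt; apply/negP => lt.
have [||v [xv vy uv hv]] := @ascent x.+1 y.+1 _ yN; first by rewrite ltnS.
  exact: leq_trans lt hy.
have : v <= lab y.
  by apply: lab_max => //; apply: leq_trans hv (leq_trans (ltnW lt) hy).
by lia.
Qed.

(** The letters of the block opened at u end at pairwise distinct heights
    between the height of u and k above it. *)
Let fibre_le u : count_mem u (labels lab 0 N) <= k.+1.
Proof.
rewrite /labels count_map -size_filter; set s := filter _ _.
have sP x : x \in s -> x < N /\ lab x = u.
  by rewrite mem_filter mem_iota /= => /andP[/eqP].
have hP x : x \in s -> ht x.+1 <= ht u + k.
  move=> /sP[xN xu]; have [ux pu hu] := lab_spec xN; rewrite xu in ux pu hu.
  rewrite -htS_up //; last exact: leq_ltn_trans xN.
  rewrite leqNgt; apply/negP => lt.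
  have [|v [uv vx pv hv]] := @ascent u.+1 x.+1 _ xN lt; first by rewrite ltnS.
  by have := @lab_max v x vx pv (leq_trans hv (ltnW lt)); rewrite xu; lia.
have nodup x y : x \in s -> y \in s -> x < y -> ht x.+1 = ht y.+1 -> False.
  move=> /sP[xN xu] /sP[yN yu] xy xyh.
  have [ux _ _] := lab_spec xN; rewrite xu in ux.
  have ny : ~~ up y by apply: contraTN xy => /(lab_up yN); lia.
  have := htS_right yN ny => hy.
  have [|v [xv vy pv hv]] := @ascent x.+1 y xy (ltnW yN); first by rewrite xyh hy.
  by have := @lab_max v y (ltnW vy) pv; rewrite -xyh yu => /(_ hv); lia.
have us : uniq [seq ht x.+1 - ht u | x <- s].
  rewrite map_inj_in_uniq; first by rewrite filter_uniq ?iota_uniq.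
  move=> x y xs ys; have /sP[xN xu] := xs; have /sP[yN yu] := ys.
  have [_ _ hx] := lab_spec xN; have [_ _ hy] := lab_spec yN.
  rewrite xu in hx; rewrite yu in hy => hxy.
  have e : ht x.+1 = ht y.+1 by lia.
  have [xy|yx|//] := ltngtP x y; first by case: (nodup x y).
  by case: (nodup y x).
rewrite -(size_map (fun x => ht x.+1 - ht u)) -(size_iota 0 k.+1).
apply: uniq_leq_size us _ => _ /mapP[x /hP hx ->].
by rewrite mem_iota /= add0n ltnS leq_subLR.
Qed.

Let size_lab : size (undup (labels lab 0 N)) <= n.
Proof.
rewrite -[X in _ <= X](size_ups_dyck p) -(size_map succn (undup _)).
apply: uniq_leq_size => [|_ /mapP[u + ->]].
  by rewrite (map_inj_uniq succn_inj) undup_uniq.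
rewrite mem_undup => /labelsP[x xN <-]; rewrite nth_ups.
by have [] := lab_spec xN.
Qed.

(** There are at most n blocks of at most k+1 letters each, and (k+1)n letters
    in all, so all these bounds are attained. *)
Let fibre_eq x : x < N -> count_mem (lab x) (labels lab 0 N) = k.+1.
Proof.
move=> xN; set s := labels lab 0 N; set l := lab x.
have ls : l \in undup s by rewrite mem_undup; apply/labelsP; exists x.
apply/eqP; rewrite eqn_leq fibre_le leqNgt; apply/negP => lt.
have : \sum_(u <- undup s) count_mem u s < \sum_(u <- undup s) k.+1.
  rewrite (big_rem l ls) [X in _ < X](big_rem l ls) /=.
  by rewrite -addSn leq_add // leq_sum // => u _; exact: fibre_le.
rewrite sum_count_undup size_map size_iota big_const_seq count_predT iter_addn_0.
by rewrite ltn_pmul2l // ltnNge size_lab.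
Qed.

Definition dyck_label (w : seq bool) (x : nat) : nat := opener w (x %% N).

Lemma dyck_label_noncrossing : 0 < n -> noncrossing n k (dyck_label p).
Proof.
move=> n0; have N0 : 0 < N by rewrite muln_gt0.
have bN x : dyck_label p (x + N) = dyck_label p x by rewrite /dyck_label modnDr.
have cross w x y z : w < x -> x < y -> y < z -> z < N ->
    lab w = lab y -> lab x = lab z -> lab w = lab x.
  move=> wx xy yz zN wy xz.
  have [lw _ _] := @lab_spec w ltac:(lia).
  have [lx _ _] := @lab_spec x ltac:(lia).
  have := @lab_nest x y ltac:(lia) ltac:(lia) ltac:(lia).
  have := @lab_nest y z ltac:(lia) ltac:(lia) ltac:(lia).
  by lia.
split=> // [a x|].
  rewrite -/(labels _ a _) (permP (labels_period bN a)) -/N.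
  rewrite (_ : labels _ 0 N = labels lab 0 N); first exact/fibre_eq/ltn_pmod.
  apply/eq_in_map => y; rewrite mem_iota add0n => yN.
  by rewrite /dyck_label modn_small.
move=> w x y z wx xy yz; rewrite -/N => zw.
(* Shift w into [0, N); the points that then exceed N wrap around, which only
   rotates the four points cyclically. *)
pose q := w %/ N * N; have wr := ltn_pmod w N0.
have wE : w = q + w %% N by rewrite /q -divn_eq.
have red v : dyck_label p v = dyck_label p (v - q) \/ v < q.
  have [qv|] := leqP q v; last by right.
  by left; rewrite -{1}(subnK qv) /dyck_label /q addnC modnMDl.
have modE v : q <= v -> v < q + 2 * N ->
   dyck_label p v = lab (if v - q < N then v - q else v - q - N).
  move=> qv vq; case: (red v) => [->|]; last by lia.
  case: ltnP => [lt|le]; first by rewrite /dyck_label modn_small.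
  by rewrite -{1}(subnK le) bN /dyck_label modn_small //; lia.
rewrite !modE; try lia.
have -> : w - q < N by lia.
case: (ltnP (x - q) N) => hx; case: (ltnP (y - q) N) => hy;
  case: (ltnP (z - q) N) => hz; try lia.
- by apply: cross; lia.
- by move=> e1 e2; rewrite -(@cross (z - q - N) (w - q) (x - q) (y - q)) //; lia.
- move=> e1 e2.
  by rewrite e1 e2; apply: (@cross (y - q - N) (z - q - N) (w - q) (x - q)); lia.
- move=> e1 e2.
  rewrite e1; apply/esym.
  by apply: (@cross (x - q - N) (y - q - N) (z - q - N) (w - q)); lia.
Qed.

(** A letter is an up step exactly when its block has no earlier letter. *)
Lemma dyck_label_count m : m <= N -> label_count (dyck_label p) 0 m = ups_upto p m.
Proof.
have labE x : x < N -> dyck_label p x = lab x.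
  by move=> xN; rewrite /dyck_label modn_small.
elim: m => [|m IH] mN; first by rewrite ups_upto0.
rewrite label_count_rcons add0n IH 1?ltnW // ups_uptoS addnC.
congr (_ + nat_of_bool _).
rewrite -/(up m); have [le ul _] := lab_spec mN; rewrite labE //.
apply/idP/idP => [|um].
  apply: contraR => um; apply/labelsP; exists (lab m).
    rewrite /= add0n ltn_neqAle le andbT; apply: contraNneq um => <-; exact: ul.
  by rewrite labE; [apply: lab_up|]; rewrite // (leq_ltn_trans le).
apply/labelsP => -[x]; rewrite add0n /= => xm; rewrite labE; last by lia.
have [lx _ _] := @lab_spec x ltac:(lia).
by rewrite (lab_up mN um) => e; lia.
Qed.

End DyckLabel.

(** * Evacuation *)

Lemma dyck_eq n k (p q : dyck n k) :
  (forall m, m <= k.+1 * n -> ups_upto p m = ups_upto q m) -> p = q.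
Proof.
move=> pq; apply/val_inj/val_inj; apply: (@eq_from_nth _ false).
  by rewrite !size_tuple.
move=> m; rewrite size_tuple => mN; have := pq _ mN.
rewrite !ups_uptoS pq 1?ltnW // => /addnI.
by case: nth; case: nth.
Qed.

Lemma is_dyckE n k (w : (k.+1 * n).-tuple bool) :
  is_dyck w = (ups_upto w (k.+1 * n) == n) &&
    [forall m : 'I_(k.+1 * n).+1, m <= k.+1 * ups_upto w m].
Proof.
rewrite /is_dyck; congr (_ && _).
  by rewrite /ups_upto take_oversize ?size_tuple.
apply: eq_forallb => m; have mN : m <= k.+1 * n by rewrite -ltnS.
rewrite count_R_U size_takel ?size_tuple // -/(ups_upto w m).
by rewrite leq_subLR -mulSn.
Qed.

Lemma ups_upto_swap N (w : N.-tuple bool) i m : 0 < i < N -> m <= N ->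
  ups_upto (swap_letters i w) m =
  if m == i then ups_upto w i.-1 + ups_upto w i.+1 - ups_upto w i
  else ups_upto w m.
Proof.
case: i => // i /andP[_ iN] mN.
have nthE j : j < N -> nth false (swap_letters i.+1 w) j =
    nth false w (if j == i then i.+1 else if j == i.+1 then i else j).
  move=> jN; rewrite -[j]/(nat_of_ord (Ordinal jN)) nth_mktuple /=.
  by rewrite eqSS.
have low : forall m, m <= i -> ups_upto (swap_letters i.+1 w) m = ups_upto w m.
  elim=> [|j IH] ji; first by rewrite !ups_upto0.
  rewrite !ups_uptoS IH 1?ltnW // nthE; last by lia.
  by rewrite !(ifN_eq, ltn_eqF) //; lia.
have mid : ups_upto (swap_letters i.+1 w) i.+1 =
    ups_upto w i + nth false w i.+1.
  by rewrite ups_uptoS low // nthE ?eqxx //; lia.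
have hi : forall m, i.+1 < m -> m <= N ->
    ups_upto (swap_letters i.+1 w) m = ups_upto w m.
  elim=> [|j IH] //; rewrite ltnS leq_eqVlt => /orP[/eqP <- _|ij jN].
    rewrite ups_uptoS mid nthE // eqxx gtn_eqF //.
    by rewrite !ups_uptoS -!addnA [X in _ + X]addnC.
  rewrite !ups_uptoS (IH ij (ltnW jN)) nthE //.
  by rewrite !gtn_eqF //; lia.
have [->|ne] := eqVneq m i.+1.
  by rewrite mid /= (ups_uptoS w i.+1) addnCA addKn.
by case: (ltngtP m i.+1) ne => [?|?|//] _; [apply: low | apply: hi]; lia.
Qed.

Lemma ups_upto_toggle n k (p : dyck n k) i m : 0 < i < k.+1 * n -> m <= k.+1 * n ->
  let c := ups_upto p i.-1 + ups_upto p i.+1 - ups_upto p i in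
  ups_upto (path_toggle i p) m =
  if (m == i) && (i <= k.+1 * c) then c else ups_upto p m.
Proof.
move=> iN mN c; have iN' : i <= k.+1 * n by lia.
have swapE := ups_upto_swap p iN.
rewrite /path_toggle /insubd.
have dE : is_dyck (swap_letters i p) = (i <= k.+1 * c).
  rewrite is_dyckE swapE // ifN_eq; last by lia.
  rewrite ups_upto_all eqxx /=; apply/forallP/idP => [/(_ (inord i))|ic j].
    by rewrite inordK // swapE // eqxx.
  have jN : j <= k.+1 * n by rewrite -ltnS.
  by rewrite swapE //; case: eqP => [->//|_]; exact: ups_upto_cover.
case: insubP => [q|] /=; rewrite dE.
  by move=> -> qE; rewrite qE swapE // andbT.
by move=> /negbTE ->; rewrite andbF.
Qed.

Section Evacuation.
Variables (n k : nat) (h : nat -> nat -> nat).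
Hypothesis hc : window_count n k h.
Let N := k.+1 * n.

(** The prefix of length m shows the window of length m at time t m, and the
    toggle advances the time of the prefix of length i.  In the exceptional case
    of the exchange rule the count does not change from one time to the next,
    and the toggle is blocked because the exchanged word has (k+1)c = i - 1. *)
Lemma toggle_window (p : dyck n k) (t : nat -> nat) i :
  0 < i < N ->
  t i.-1 = (t i).+1 \/ i = 1 -> t i.+1 = t i ->
  (forall m, m <= N -> ups_upto p m = h (t m) m) ->
  forall m, m <= N ->
    ups_upto (path_toggle i p) m = h (if m == i then (t i).+1 else t m) m.
Proof.
case: i => // i iN tl tr pt m mN; rewrite ups_upto_toggle //= !pt; try lia.
have -> : h (t i) i = h (t i.+1).+1 i.
  by case: tl => [/= -> //|[->]]; rewrite !(count0 hc).
rewrite tr; have [->|_] := eqVneq m i.+1; last by [].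
rewrite /=; set a := t i.+1; have := count_square hc a (L := i) ltac:(lia).
have := count_cover hc a.+1 (L := i.+1) ltac:(lia).
set c := _ - h a i.+1; move=> cov [sq|[e1 e2 e3 e4]].
  by have -> : c = h a.+1 i.+1 by [rewrite /c; lia]; rewrite cov.
have -> : c = h a.+1 i by rewrite /c; lia.
by rewrite -e4 ltnn e1 e2.
Qed.

(** Each round of toggles stops one position earlier than the previous one, so
    the prefix of length m is left alone from round N - m on. *)
Let stage (p : dyck n k) s :=
  forall m, m <= N -> ups_upto p m = h (minn s (N - m)) m.

Lemma stage_promotion p j : j < N -> stage p (N.-1 - j) ->
  stage (prodmap [seq @path_toggle n k i | i <- rev (iota 1 j)] p) (N - j).
Proof.
move=> jN pj; set s := N.-1 - j.
have key r : r <= j -> forall m, m <= N ->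
   ups_upto (prodmap [seq @path_toggle n k i | i <- rev (iota 1 r)] p) m =
   h (if 0 < m <= r then s.+1 else minn s (N - m)) m.
  elim: r => [|r IH] rj m mN.
    by rewrite /= pj //; case: m mN => [|m] _; rewrite ?(count0 hc).
  have -> : rev (iota 1 r.+1) = r.+1 :: rev (iota 1 r).
    by rewrite -[X in iota 1 X]addn1 iotaD rev_cat add1n.
  rewrite /= (toggle_window
    (t := fun m => if 0 < m <= r then s.+1 else minn s (N - m))) //.
  - by congr (h _ m); rewrite /s; case: eqP => [->|?]; do !case: ifP; lia.
  - by lia.
  - case: r rj {IH} => [|r] rj; [by right | left => /=]; rewrite /s; do !case: ifP; lia.
  - by rewrite /s; do !case: ifP; lia.
  - by apply: IH; lia.
move=> m mN; rewrite key //; case: m mN => [|m] mN; first by rewrite !(count0 hc).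
by congr (h _ _); rewrite /s; case: ifP; lia.
Qed.

Lemma ev_window (p : dyck n k) : 0 < n ->
  (forall m, m <= N -> ups_upto p m = h 0 m) ->
  forall m, m <= N -> ups_upto (ev p) m = h (N - m) m.
Proof.
move=> n0 ph.
have key r : r <= N.-1 ->
    stage (prodmap [seq prodmap [seq @path_toggle n k i | i <- rev (iota 1 j)]
                   | j <- iota (N - r) r] p) r.
  elim: r => [|r IH] rN; first by move=> m mN /=; rewrite min0n ph.
  rewrite /= -/N; have rE : N.-1 - (N - r.+1) = r by lia.
  have -> : (N - r.+1).+1 = N - r by lia.
  have := @stage_promotion (prodmap _ p) (N - r.+1) _ _.
  rewrite rE subKn; last by lia.
  by apply; [lia | apply: IH; lia].
have N0 : 0 < N by rewrite muln_gt0.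
move=> m mN; have := key N.-1 (leqnn _) m mN; have -> : N - N.-1 = 1 by lia.
rewrite /ev => ->; case: m mN => [|m] mN; first by rewrite !(count0 hc).
by congr (h _ _); lia.
Qed.

End Evacuation.

(** * Box toggles *)

Section Rows.
Variables (n k : nat) (h : nat -> nat -> nat).
Hypothesis hc : window_count n k h.
Let N := k.+1 * n.

Lemma window_sub a L a' L' : a <= a' -> a' + L' <= a + L -> h a' L' <= h a L.
Proof.
move=> aa e.
have growr z l y : h z l <= h z (l + y).
  elim: y => [|y IH]; first by rewrite addn0.
  by rewrite addnS; have := count_stepr hc z (l + y); lia.
have growl x z l : h (z + x) l <= h z (x + l).
  elim: x z => [|x IH] z; first by rewrite addn0.
  rewrite addnS -addSn; apply: leq_trans (IH _) _.
  by rewrite addSn; have := count_stepl hc z (x + l); lia.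
apply: leq_trans (growr a' L' (a + L - (a' + L'))) _.
rewrite -(subnKC aa); apply: leq_trans (growl _ _ _) _.
by rewrite (_ : _ + _ = L) //; lia.
Qed.

Lemma window_grow a L x y : h a (x + L + y) <= h (a + x) L + x + y.
Proof.
elim: y => [|y IH]; last first.
  by rewrite addnS; have := count_stepr hc a (x + L + y); lia.
rewrite !addn0; elim: x a => [|x IH] a; first by rewrite !addn0.
have := count_stepl hc a (x + L); have := IH a.+1.
by rewrite !addSn !addnS; lia.
Qed.

Lemma window_dist a L a' L' :
  h a' L' <= h a L + (a - a') + (a' + L' - (a + L)).
Proof.
pose m := a - (a - a').
apply: leq_trans (_ : h m ((a - a') + L + (a' + L' - (a + L))) <= _).
  by apply: window_sub; rewrite /m; lia.
apply: leq_trans (window_grow _ _ _ _) _.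
by rewrite (_ : m + (a - a') = a) // /m; lia.
Qed.

Lemma window_size a L : h a L <= L.
Proof. by have := window_dist a 0 a L; rewrite (count0 hc); lia. Qed.

Lemma window_total a L : L <= N -> h a L <= n.
Proof.
by move=> LN; rewrite -[X in _ <= X](count_full hc a) window_sub // leq_add2l.
Qed.

(** Equivalently, more than c.1 blocks are contained in the cyclic interval
    complementary to the window. *)
Definition in_at (c : box n k) (t : nat) : bool :=
  h (c.1 + t) (n + c.2 - c.1) <= n - c.1.+1.

Definition at_times (A : {set box n k}) (th : box n k -> nat) : Prop :=
  forall c, (c \in A) = in_at c (th c).

(** Boxes may be at different times, as long as going up or left by one box
    advances the time by zero or one; [slow_filter] shows that such a family of
    times always defines a filter. *)
Definition slow (th : box n k -> nat) : Prop :=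
  forall c d : box n k, box_le c d ->
  th c <= th d <= th c + (c.1 - d.1) + (c.2 - d.2).

(** Going up from row c.1 to row d.1 raises the threshold by c.1 - d.1, and
    slowness bounds by the same number the positions gained by the window. *)
Lemma slow_filter th : slow th -> is_filter [set c | in_at c (th c)].
Proof.
move=> sth; apply/forallP => c; apply/forallP => d; apply/implyP.
rewrite !inE /in_at => /andP[cin cd]; have := sth c d cd.
case/andP: cd => d1 d2; have := ltn_ord c.1; have := ltn_ord d.1 => dn cn tcd.
have := window_dist (c.1 + th c) (n + c.2 - c.1) (d.1 + th d) (n + d.2 - d.1).
by lia.
Qed.

Lemma toggle_flip (A B : filter_of n k) (c : box n k) :
  (forall d, d != c -> (d \in (A : {set _})) = (d \in (B : {set _}))) ->
  (c \in (A : {set _})) != (c \in (B : {set _})) -> filter_toggle c A = B.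
Proof.
move=> AB cAB; rewrite /filter_toggle.
have -> : (if c \in (A : {set _}) then A :\ c else c |: A) = val B.
  apply/setP => d; have [->|dc] := eqVneq d c.
    by move: cAB; case: ifP => [_|_]; rewrite ?setD11 ?setU11 /=; case: (c \in _).
  by case: ifP => _; rewrite !inE (negbTE dc) AB.
by rewrite /insubd valK.
Qed.

Lemma toggle_stay (A : filter_of n k) (c d : box n k) : d != c ->
  (if c \in (A : {set _}) then (d \in (A : {set _})) && box_le d c
   else (d \notin (A : {set _})) && box_le c d) ->
  filter_toggle c A = A.
Proof.
move=> dc dA; rewrite /filter_toggle /insubd insubN //.
apply/negP => /forallP f; case: ifP dA f => cA /andP[dA le] f.
  have /forallP/(_ c)/implyP := f d.
  by rewrite !inE dc dA le eqxx => /(_ isT).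
have /forallP/(_ d)/implyP := f c.
by rewrite !inE eqxx le (negbTE dc) (negbTE dA) => /(_ isT).
Qed.

Lemma mk_box i j : i < n -> j < k * (n - i.+1) ->
  exists d : box n k, d.1 = i :> nat /\ d.2 = j :> nat.
Proof.
move=> iN jN; have jN' : j < k * n.
  by apply: leq_trans jN _; rewrite leq_mul2l leq_subr orbT.
by exists (@Box n k (Ordinal iN, Ordinal jN') jN).
Qed.

Lemma box_neq (c d : box n k) : (d.1 != c.1 :> nat) || (d.2 != c.2 :> nat) -> d != c.
Proof. by apply: contraTneq => ->; rewrite !eqxx. Qed.

(** If the membership of c differs at the two times, the toggle performs the
    change, since both sets are filters.  Otherwise the toggle has to be
    blocked: the exchange rule for the two windows of c produces a box just
    below c that is in the filter, or one just above c that is not.  The four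
    neighbours of c see exactly the intersection or the union of the two windows
    of c, with thresholds shifted by at most one.  Where the neighbour would lie
    outside the poset, the bounds on the counts exclude the case. *)
Lemma toggle_advance (A : filter_of n k) (th th' : box n k -> nat) c :
  slow th -> slow th' -> th' c = (th c).+1 -> (forall d, d != c -> th' d = th d) ->
  at_times A th -> at_times (filter_toggle c A) th'.
Proof.
move=> sl sl' th'c th'd Ath.
pose B := Filter (slow_filter sl').
suff -> : filter_toggle c A = B by move=> d; rewrite inE.
have AB d : d != c -> (d \in (A : {set _})) = (d \in (B : {set _})).
  by move=> dc; rewrite Ath inE th'd.
have [cAB|] := eqVneq (c \in (A : {set _})) (c \in (B : {set _}));
  last exact: toggle_flip.
suff [d dc dP] : exists2 d, d != c &
    if c \in (A : {set _}) then (d \in (A : {set _})) && box_le d c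
    else (d \notin (A : {set _})) && box_le c d.
  rewrite (toggle_stay dc dP); apply/val_inj/setP => e.
  by have [->|/AB] := eqVneq e c.
(* Slowness before and after the toggle determines the time of the boxes that
   cover c or are covered by c. *)
have up d : d != c -> box_le c d -> (d.1 + d.2).+1 = c.1 + c.2 -> th d = (th c).+1.
  move=> dc cd e; have := sl c d cd; have := sl' c d cd.
  by rewrite th'c th'd //; case/andP: cd; lia.
have down d : d != c -> box_le d c -> d.1 + d.2 = (c.1 + c.2).+1 -> th d = th c.
  move=> dc cd e; have := sl d c cd; have := sl' d c cd.
  by rewrite th'c th'd //; case/andP: cd; lia.
have cP : c.2 < k * (n - c.1.+1) by case: (c).
move: cAB; rewrite (Ath c) inE th'c /in_at.
have : c.1 < n := ltn_ord c.1.
set i : nat := c.1 in cP up down *; set j : nat := c.2 in cP up down * => iN.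
pose r := n - i.+1; have rE : n = r + i.+1 by rewrite /r; lia.
(* The windows of c at the two times are [a, a+L] and [a+1, a+L+1]. *)
pose a := i + th c; pose L := r + j.
have NE : N = n + k * r + k * i.+1 by rewrite /N mulSn {2}rE mulnDr addnA.
have krj : j < k * r by [].
have LN : L.+2 <= k.+1 * n.
  by rewrite -/N NE /L mulnS; case: (k) krj => [|k'] krj; rewrite ?mul0n in krj *; lia.
have -> : n + j - i = L.+1 by rewrite /L; lia.
rewrite addnS -/r -/a => cAB.
have sq := count_square hc a LN.
have coverM := count_cover hc a.+1 (L := L) ltac:(lia).
have coverB := count_cover hc a (L := L.+2) LN.
case le : (h a L.+1 <= r) cAB => /esym le'.
  (* c is in both filters: look for a member just below c, in the next row if
     the intersection meets few blocks, in the next column if the union does. *)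
  have [M|B'] : h a.+1 L < r \/ h a L.+2 <= r.
  - by case: sq => [|[]]; lia.
  - have r0 : 0 < r by lia.
    have jlow : j < k * (n - i.+2).
      have -> : n - i.+2 = r.-1 by rewrite /r; lia.
      have : L <= k.+1 * r.-1 by apply: leq_trans coverM _; rewrite leq_mul2l; lia.
      by rewrite mulSn /L; lia.
    have [|d [d1 d2]] := @mk_box i.+1 j _ jlow; first by lia.
    have dc : d != c by apply: box_neq; rewrite d1 /i; lia.
    have le_dc : box_le d c by rewrite /box_le d1 d2 leqnSn leqnn.
    have td : th d = th c by apply: down => //; rewrite d1 d2; lia.
    exists d => //; rewrite le_dc andbT Ath /in_at td d1 d2.
    have -> : n + j - i.+1 = L by rewrite /L; lia.
    by rewrite addSn -/a; lia.
  - have jr : j.+1 < k * (n - i.+1).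
      have : L.+2 <= k.+1 * r by apply: leq_trans coverB _; rewrite leq_mul2l B' orbT.
      by rewrite mulSn /L -/r; lia.
    have [d [d1 d2]] := @mk_box i j.+1 iN jr.
    have dc : d != c by apply: box_neq; rewrite d2 /j; lia.
    have le_dc : box_le d c by rewrite /box_le d1 d2 leqnSn leqnn.
    have td : th d = th c by apply: down => //; rewrite d1 d2; lia.
    exists d => //; rewrite le_dc andbT Ath /in_at td d1 d2.
    have -> : n + j.+1 - i = L.+2 by rewrite /L; lia.
    by rewrite -/a -/r; lia.
(* c is in neither filter: look for a missing box to the left of c or above it. *)
have [M|B'] : r < h a.+1 L \/ r.+1 < h a L.+2.
- case: sq => [|[e1 e2 e3 e4]]; first by lia.
  left; rewrite ltnNge; apply/negP => lM.
  have Mr : h a.+1 L = r by lia.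
  by move: e4; rewrite Mr mulSn /L; lia.
- have j0 : 0 < j by have := leq_trans M (window_size a.+1 L); rewrite /L; lia.
  have [|d [d1 d2]] := @mk_box i j.-1 iN; first by rewrite -/r; lia.
  have dc : d != c by apply: box_neq; rewrite d2 /j; lia.
  have le_cd : box_le c d by rewrite /box_le d1 d2 leqnn leq_pred.
  have td : th d = (th c).+1 by apply: up => //; rewrite d1 d2; lia.
  exists d => //; rewrite le_cd andbT Ath /in_at td d1 d2.
  have -> : n + j.-1 - i = L by rewrite /L; lia.
  by rewrite addnS -/a -/r; lia.
have i0 : 0 < i by have := window_total a LN; lia.
have [||d [d1 d2]] := @mk_box i.-1 j; first by lia.
  have -> : n - i.-1.+1 = r.+1 by lia.
  by rewrite mulnS; lia.
have dc : d != c by apply: box_neq; rewrite d1 /i; lia.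
have le_cd : box_le c d by rewrite /box_le d1 d2 leqnn leq_pred.
have td : th d = (th c).+1 by apply: up => //; rewrite d1 d2; lia.
exists d => //; rewrite le_cd andbT Ath /in_at td d1 d2.
have -> : n + j - i.-1 = L.+2 by rewrite /L; lia.
have -> : i.-1 + (th c).+1 = a by rewrite /a; lia.
by lia.
Qed.

End Rows.

(** * Rowmotion and rowvacuation *)

Lemma box_sum_lt n k (c : box n k) : c.1 + c.2 < n.-1 * k.
Proof.
have cn := ltn_ord c.1; have : c.2 < k * (n - c.1.+1) by case: (c).
have -> : n.-1 = c.1 + (n - c.1.+1) by lia.
set r := n - _; move: (nat_of_ord c.1) (nat_of_ord c.2) => i j kr.
by rewrite mulnDl [r * k]mulnC -addnS leq_add // leq_pmulr //; case: (k) kr.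
Qed.

Lemma box_rank_le n k (c d : box n k) : box_le c d ->
  box_rank d = box_rank c + (c.1 - d.1) + (c.2 - d.2).
Proof.
have := box_sum_lt c; have := box_sum_lt d; rewrite /box_le /box_rank => dl cl.
by case/andP; lia.
Qed.

Section RankToggles.
Variables (n k : nat) (h : nat -> nat -> nat).
Hypothesis hc : window_count n k h.

(** When the time of a box depends on its rank only, slowness is the condition
    that it grows by at most one from each rank to the next. *)
Definition slow_seq (t : nat -> nat) : Prop := forall q, t q <= t q.+1 <= (t q).+1.

Lemma slow_seqD t : slow_seq t -> forall q x, t q <= t (q + x) <= t q + x.
Proof.
move=> st q; elim=> [|x IH]; first by rewrite !addn0 leqnn.
by rewrite !addnS; have := st (q + x); lia.
Qed.

(** The toggles of one rank can be performed one at a time: the intermediate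
    times, in which only the boxes of D have advanced, stay slow. *)
Lemma slow_ranks t i (D : {pred box n k}) : slow_seq t ->
  slow_seq (fun q => t q + (q == i)) -> {in D, forall c, box_rank c = i} ->
  slow (fun c : box n k => t (box_rank c) + (c \in D)).
Proof.
move=> st st' Di c d cd; rewrite -addnA.
have := box_rank_le cd; set x := _ - d.1 + _ => rd.
have [x0|x0] := posnP x.
  have -> : d = c.
    move: x0 (cd); rewrite /x /box_le => x0 /andP[? ?].
    by apply/val_inj/pair_eqP/andP; split; apply/eqP/val_inj => /=; lia.
  by rewrite x0 addn0 leqnn.
have := slow_seqD st (box_rank c) x; have := slow_seqD st' (box_rank c) x.
have -> : box_rank c + x = box_rank d by rewrite rd addnA.
have rcd : box_rank c != box_rank d by rewrite rd -addnA; lia.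
have [/Di ci|_] := boolP (c \in D); have [/Di di|_] := boolP (d \in D).
- by move: rcd; rewrite ci di eqxx.
- by rewrite /= ci eqxx; case: eqP => /=; lia.
- by rewrite /= di eqxx; case: eqP => /=; lia.
- by lia.
Qed.

Lemma rank_toggle_advance (A : filter_of n k) t t' i :
  slow_seq t -> slow_seq t' -> (forall q, t' q = t q + (q == i)) ->
  at_times h A (fun c => t (box_rank c)) ->
  at_times h (rank_toggle i A) (fun c => t' (box_rank c)).
Proof.
move=> st st' t'E At.
have st1 : slow_seq (fun q => t q + (q == i)) by move=> q; rewrite -!t'E.
pose s := enum [pred c : box n k | box_rank c == i].
have s_rank c : (c \in s) = (box_rank c == i) by rewrite mem_enum.
have toggled (r : seq (box n k)) : uniq r -> {subset r <= s} ->
    at_times h (prodmap [seq filter_toggle c | c <- r] A)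
      (fun c => t (box_rank c) + (c \in r)).
  elim: r => [_ _ c|c r IH /= /andP[cr ur] rs].
    by rewrite At in_nil addn0.
  have rs' : {subset r <= s} by move=> d dr; apply: rs; rewrite inE dr orbT.
  have slow_r (r' : seq (box n k)) : {subset r' <= s} ->
      slow (fun c => t (box_rank c) + (c \in r')).
    move=> r's; apply: (slow_ranks (i := i)) => // d /r's.
    by rewrite s_rank => /eqP.
  apply: (toggle_advance hc (slow_r _ rs') (slow_r _ rs) _ _ (IH ur rs')).
    by rewrite inE eqxx (negbTE cr) addn0 addn1.
  by move=> d dc; rewrite inE (negbTE dc).
move=> c; rewrite /rank_toggle (toggled s) ?enum_uniq //.
by rewrite t'E s_rank.
Qed.

(** The factor t_a ... t_r, applied after the factors with smaller a, advances
    all ranks from a on. *)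
Lemma rank_round (A : filter_of n k) a : a <= n.-1 * k ->
  at_times h A (fun c => minn (box_rank c).+1 a) ->
  at_times h (prodmap [seq @rank_toggle n k i | i <- iota a (n.-1 * k - a)] A)
    (fun c => minn (box_rank c).+1 a.+1).
Proof.
set M := n.-1 * k => aM Aa.
(* The times when the ranks from s on have been toggled. *)
pose t s q := if s <= q then a.+1 else minn q.+1 a.
have st s : a <= s -> slow_seq (t s).
  by move=> as_ q; rewrite /t; do 2!case: ifP; lia.
have round x : x <= M - a ->
    at_times h (prodmap [seq @rank_toggle n k i | i <- iota (M - x) x] A)
      (fun c => t (M - x) (box_rank c)).
  elim: x => [_ c|x IH xM].
    rewrite Aa subn0 /t ifN // -ltnNge /box_rank.
    by have := box_sum_lt c; rewrite -/M; lia.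
  have e : (M - x.+1).+1 = M - x by lia.
  have -> : iota (M - x.+1) x.+1 = (M - x.+1) :: iota (M - x) x by rewrite /= e.
  rewrite [prodmap _]/= [(_ \o _) _]/=.
  apply: (rank_toggle_advance (t := t (M - x))); try (by apply: st; lia).
    by move=> q; rewrite /t; case: eqP => /=; do 2!case: ifP; lia.
  by apply: IH; lia.
have e : M - (M - a) = a by lia.
have := round _ (leqnn (M - a)); rewrite e => R c.
by rewrite R /t; congr (in_at _ _ _); case: ifP; lia.
Qed.

Lemma rowmotion_window (A : filter_of n k) :
  at_times h A (fun=> 0) -> at_times h (filter_rowmotion A) (fun=> 1).
Proof.
move=> A0; rewrite /filter_rowmotion -(subn0 (n.-1 * k)) => c.
by rewrite rank_round.
Qed.

Lemma rowvacuation_window (A : filter_of n k) :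
  at_times h A (fun=> 0) ->
  at_times h (filter_rowvacuation A) (fun c => (box_rank c).+1).
Proof.
move=> A0; set M := n.-1 * k.
have rounds x : x <= M ->
    at_times h (prodmap [seq prodmap [seq @rank_toggle n k i | i <- iota a (M - a)]
                        | a <- rev (iota 0 x)] A)
      (fun c => minn (box_rank c).+1 x).
  elim: x => [_ c|x IH xM]; first by rewrite A0 minn0.
  have -> : rev (iota 0 x.+1) = x :: rev (iota 0 x).
    by rewrite -[X in iota 0 X]addn1 iotaD rev_cat.
  rewrite /=; apply: rank_round; first exact: ltnW.
  by apply: IH; apply: ltnW.
move=> c; rewrite /filter_rowvacuation -/M rounds //; congr (in_at _ _ _).
by have := box_sum_lt c; rewrite /box_rank -/M; lia.
Qed.

End RankToggles.

Lemma window_shift n k h s : window_count n k h ->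
  window_count n k (fun a L => h (a + s) L).
Proof.
by case=> h0 hN hr hl hcov hsq; split=> [a|a|a L|a L|a L|a L]; rewrite ?addSn //;
  [exact: hcov | exact: hsq].
Qed.

Lemma rowmotion_iter n k h (A B : filter_of n k) s : window_count n k h ->
  at_times h A (fun=> 0) -> at_times h B (fun=> s) ->
  B = iter s (@filter_rowmotion n k) A.
Proof.
move=> hc A0 Bs; have key : at_times h (iter s (@filter_rowmotion n k) A) (fun=> s).
  elim: s {Bs} => [//|s IH] c /=.
  have hs := window_shift s hc.
  rewrite (rowmotion_window hs) => [|d]; last by rewrite IH /in_at addn0.
  by rewrite /in_at -addnA.
by apply/val_inj/setP => c; rewrite Bs key.
Qed.

(** * Initial segments of rotated lists *)

Lemma take_count_pairwise (T : Type) (P : pred T) (s : seq T) :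
  pairwise (fun x y => P y ==> P x) s -> take (count P s) s = filter P s.
Proof.
elim: s => //= x s IH /andP[xs /IH <-]; case: ifP => [//|Px] /=.
suff -> : count P s = 0 by rewrite take0.
apply/eqP; rewrite -leqn0 leqNgt -has_count -all_predC.
by apply: sub_all xs => y /=; rewrite Px implybF.
Qed.

Lemma pairwise_sub_in (T : eqType) (r r' : rel T) (s : seq T) :
  {in s &, forall x y, r x y -> r' x y} -> pairwise r s -> pairwise r' s.
Proof.
elim: s => //= x s IH rr' /andP[/allP xs rs]; apply/andP; split.
  by apply/allP => y ys; apply: rr' (xs y ys); rewrite inE ?eqxx ?ys ?orbT.
by apply: IH rs => y z ys zs; apply: rr'; rewrite inE ?ys ?zs orbT.
Qed.

(** Reading s cyclically from a, the elements satisfying P come first if P is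
    inherited by predecessors in that order.  The three conditions run over the
    possible positions of two elements relative to a. *)
Lemma mem_take_rot (T : eqType) (r : rel T) (P : pred T) (s : seq T) a m :
  pairwise r s -> uniq s -> a \in s -> P a -> count P s = m ->
  {in s &, forall x y, P y -> r a x -> r x y -> P x} ->
  {in s &, forall x y, P y -> r a x -> r y a -> P x} ->
  {in s &, forall x y, P y -> r x y -> r y a -> P x} ->
  forall z, (z \in take m (rot (index a s) s)) = P z && (z \in s).
Proof.
move=> rs us aS Pa <- H1 H2 H3 z.
have ts : perm_eq (rot (index a s) s) s by rewrite perm_rot.
rewrite -(permP ts) take_count_pairwise ?mem_filter ?(perm_mem ts) //.
case/splitPr: aS rs us H1 H2 H3 {ts} => s1 s2.
rewrite pairwise_cat cat_uniq /= => /and4P[]; rewrite allrel_consr.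
case/andP=> r1a r12 r1 ra2 r2 /and3P[_ /norP[a1 _] _] H1 H2 H3.
rewrite index_cat (negbTE a1) /= eqxx addn0 rot_size_cat pairwise_cat /=.
have in1 x : x \in s1 -> x \in s1 ++ a :: s2 by rewrite mem_cat => ->.
have in2 x : x \in s2 -> x \in s1 ++ a :: s2.
  by rewrite mem_cat inE => ->; rewrite !orbT.
have Pimp t : all (fun y => P y ==> P a) t by apply/allP => x _; rewrite Pa implybT.
rewrite allrel_consl !Pimp /=; apply/and3P; split.
- apply/allrelP => x y x2 y1; apply/implyP => Py.
  by apply: (H2 x y) => //; [exact: in2 | exact: in1 | exact: (allP ra2) | exact: (allP r1a)].
- apply: pairwise_sub_in r2 => x y x2 y2 xy; apply/implyP => Py.
  by apply: (H1 x y) => //; [exact: in2 | exact: in2 | exact: (allP ra2)].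
apply: pairwise_sub_in r1 => x y x1 y1 xy; apply/implyP => Py.
by apply: (H3 x y) => //; [exact: in1 | exact: in1 | exact: (allP r1a)].
Qed.

(** * The matching map *)

Lemma labels_eq_sub b a L a' L' : a <= a' -> a' + L' <= a + L ->
  label_count b a L <= label_count b a' L' -> labels b a' L' =i labels b a L.
Proof.
move=> aa e cnt l; rewrite -mem_undup -[RHS]mem_undup.
have sub : {subset undup (labels b a' L') <= undup (labels b a L)}.
  move=> u; rewrite !mem_undup => /labelsP[x xr <-]; apply/labelsP.
  by exists x => //; lia.
by have [_ ->] := uniq_min_size (undup_uniq _) sub cnt.
Qed.

Section Blocks.
Variables (n k : nat) (b : nat -> nat).
Hypothesis nc : noncrossing n k b.
Let N := k.+1 * n.

(** [block_upward] and [block_downward]: when every label met lies in the window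
    of length L + 1 and the label at one end point of the window is fresh, the
    block of this end point is an initial segment of the positions read
    cyclically away from the window.  An interposed position x would belong to
    a block meeting the window elsewhere, which would have to cross. *)
Lemma block_upward a L x y : b (a + L) \notin labels b a L -> L < N ->
  a + L < x -> x < y -> y < a + L + N -> b y = b (a + L) ->
  b x \in labels b a L.+1 -> b x = b (a + L).
Proof.
move=> ba LN ax xy yN by_ /labelsP[z zr zx].
have [ze|ze] := eqVneq z (a + L); first by rewrite -zx ze.
rewrite -zx; apply: (label_nocross nc (y := x) (z := y)); rewrite -/N //; try lia.
rewrite ltnNge; apply: contra ba => zy; apply/labelsP.
exists (y - N); first by lia.
by rewrite -by_ -[in RHS](subnK (_ : N <= y)) ?(label_periodic nc) //; lia.
Qed.

Lemma block_downward a L x y : b a \notin labels b a.+1 L ->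
  a < y -> y < x -> x < a + N -> b y = b a ->
  b x \in labels b a L.+1 -> b x = b a.
Proof.
move=> ba ay yx xN by_ /labelsP[z zr zx].
have [ze|ze] := eqVneq z a; first by rewrite -zx ze.
rewrite -zx; apply/esym; apply: (label_nocross nc (y := y) (z := x)); rewrite -/N //; try lia.
rewrite ltnNge; apply: contra ba => zy; apply/labelsP.
by exists y => //; lia.
Qed.

End Blocks.

(** In this section [p] is a path whose filter is described by the counts of the
    reflection of [b]; the window is written for [b] itself. *)
Section Matching.
Variables (n k : nat) (b : nat -> nat) (A : filter_of n k).
Hypothesis n0 : 0 < n.
Hypothesis nc : noncrossing n k b.
Let N := k.+1 * n.
Let g := label_count b.
Hypothesis Ab : forall c : box n k,
  (c \in (A : {set _})) = (g (k * n - c.2) (n + c.2 - c.1) <= n - c.1.+1).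
Let p := path_of_filter A.
Let rho := row_length A.
Let gc := label_count_window nc.

Lemma rights_before_filter i : i < n -> rights_before p i = rho i.
Proof.
move=> ni; have := up_posE p ni; rewrite /up_pos /= ups_word.
- by rewrite nth_boundary_ups // => /addIn.
- exact/boundary_ups_sorted/filterP.
- exact/boundary_ups_range/filterP.
Qed.

Let rho_le i : rho i <= k * (n - i.+1).
Proof. exact/row_length_bound/filterP. Qed.

Let rho_mono i : rho i.+1 <= rho i.
Proof. by apply: row_length_mono => //; exact: filterP. Qed.

Let split_n i : i < n -> k * n = k * (n - i.+1) + k * i + k.
Proof.
by move=> ni; rewrite -mulnDr addnC -mulnS; congr (_ * _); lia.
Qed.

Let rho_lt i j : i < n -> j < k * (n - i.+1) ->
  (j < rho i) = (g (k * n - j) (n + j - i) <= n - i.+1).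
Proof.
move=> ni jk; have [d [d1 d2]] := mk_box ni jk.
have := Ab d; rewrite d1 d2 => <-.
by rewrite (mem_row_length (filterP A)) d1 d2.
Qed.

(* The position, from 0, of the unbarred key that row i has when it has a
   corner.  The window of length n - i + rho i starting there ends just before
   N - i, at the barred key. *)
Let e i := k * n - rho i.

(** The row length is the largest that the inequality of [Ab] allows, so adding
    the position e i to the window adds the (n-i)-th label. *)
Lemma corner_count i : i < n ->
  g (e i) (n - i + rho i) = n - i /\ g (e i).+1 (n - i.+1 + rho i) = n - i.+1.
Proof.
move=> ni; have rl := rho_le i; have := split_n ni => kn.
have nE : n - i = (n - i.+1).+1 by lia.
have up : g (e i).+1 (n - i.+1 + rho i) <= n - i.+1.
  have [r0|r0] := posnP (rho i).
    by rewrite r0 addn0; apply: (window_size gc).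
  have := @rho_lt i (rho i).-1 ni; rewrite prednK // leqnn => /(_ rl) /esym.
  by congr (g _ _ <= _); rewrite /e; lia.
have low : n - i.+1 < g (e i) (n - i + rho i).
  move: rl; rewrite leq_eqVlt => /orP[/eqP r|r].
    have := count_cover gc (e i) (L := n - i + rho i).
    rewrite -/g nE addSn r -mulSn => cov; rewrite -(ltn_pmul2l (ltn0Sn k)).
    by apply: cov; rewrite ltn_pmul2l //; lia.
  have := rho_lt ni r; rewrite ltnn => /esym/negbT; rewrite -ltnNge.
  by congr (_ < g _ _); lia.
have := count_stepl gc (e i) (n - i.+1 + rho i).
rewrite -/g -addSn -nE => st.
by split; lia.
Qed.

(** The labels of the blocks that remain before step i. *)
Definition left_labels i := labels b (e i) (n - i + rho i).
Let turn i := rho i.+1 < rho i.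
(** The label of the key of row i, which is unbarred when row i has a corner. *)
Definition next_label i := if turn i then b (e i) else b (N - i.+1).

Lemma left_labels0 : left_labels 0 =i labels b 0 N.
Proof.
have inN : e 0 + (n - 0 + rho 0) <= 0 + N.
  by have := rho_le 0; have := split_n n0; rewrite /e subn0 /N mulSn; lia.
have cN : g 0 N <= g (e 0) (n - 0 + rho 0).
  by have [-> _] := corner_count n0; rewrite subn0; apply: (window_total gc).
exact: labels_eq_sub (leq0n _) inN cN.
Qed.

Lemma left_labelsE i : i < n ->
  left_labels i = labels b (e i) (n - i.+1 + rho i).+1.
Proof. by move=> ni; rewrite -addSn -subSn. Qed.

Lemma window_end i : i < n -> e i + (n - i.+1 + rho i) = N - i.+1.
Proof.
by move=> ni; have := rho_le i; have := split_n ni; rewrite /e /N mulSn; lia.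
Qed.

Lemma corner_countS i : i < n -> g (e i.+1) (n - i.+1 + rho i.+1) = n - i.+1.
Proof.
rewrite leq_eqVlt => /orP[/eqP ->|ni]; last by have [] := corner_count ni.
have := rho_le n; rewrite (_ : n - n.+1 = 0) ?muln0 ?leqn0; last by lia.
by move=> /eqP ->; rewrite subnn /g (count0 gc).
Qed.

Lemma first_fresh i : i < n ->
  b (e i) \notin labels b (e i).+1 (n - i.+1 + rho i).
Proof.
move=> ni; have [] := corner_count ni.
have -> : n - i + rho i = (n - i.+1 + rho i).+1 by rewrite -addSn -subSn.
by rewrite /g label_count_cons -/g => + c2; rewrite c2; case: (_ \in _) => //=; lia.
Qed.

Lemma last_fresh i : i < n -> ~~ turn i ->
  b (N - i.+1) \notin labels b (e i) (n - i.+1 + rho i).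
Proof.
move=> ni t; have re : rho i.+1 = rho i.
  by have := rho_mono i; move: t; rewrite /turn; lia.
have [] := corner_count ni; have := corner_countS ni.
have -> : n - i + rho i = (n - i.+1 + rho i).+1 by rewrite -addSn -subSn.
rewrite /g label_count_rcons -/g window_end // /e re => -> + _.
by case: (_ \in _) => //=; lia.
Qed.

(** Passing to the next row shrinks the window and lowers the count by one; the
    label lost is the one at the end of the window given by the key. *)
Lemma left_labelsS i : i < n ->
  forall l, (l \in left_labels i.+1) = (l \in left_labels i) && (l != next_label i).
Proof.
move=> ni l; rewrite (left_labelsE ni) /next_label /left_labels.
case: ifP => t.
  have [_ c2] := corner_count ni; have ba := first_fresh ni.
  have -> : (l \in labels b (e i) (n - i.+1 + rho i).+1) =
            (l == b (e i)) || (l \in labels b (e i).+1 (n - i.+1 + rho i)) by [].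
  rewrite (@labels_eq_sub b (e i).+1 (n - i.+1 + rho i) (e i.+1)); last 3 first.
  - by move: t; rewrite /turn /e; have := rho_le i; have := split_n ni; lia.
  - by have := rho_le i; have := split_n ni; have := rho_mono i; rewrite /e; lia.
  - by rewrite -/g c2 corner_countS.
  by have [->|] := eqVneq l (b (e i)); rewrite ?(negbTE ba) ?andbF //= andbT.
have ba := last_fresh ni (negbT t).
have re : rho i.+1 = rho i by have := rho_mono i; move: t; rewrite /turn; lia.
rewrite /e re -/(e i) labels_rcons mem_rcons inE window_end //.
by have [->|] := eqVneq l (b (N - i.+1)); rewrite ?(negbTE ba) ?andbF //= andbT.
Qed.

(** The letter before the up step of row i is the up step of the next row below
    exactly when the two rows have the same length. *)
Lemma mat_keyE i : i < n ->
  mat_key n k p i = if turn i then (false, (e i).+1) else (true, N - i).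
Proof.
move=> ni; rewrite /mat_key (up_posE p ni) rights_before_filter //.
have [t|t] := boolP (turn i); last first.
  have re : rho i = rho i.+1 by move: t; rewrite /turn -leqNgt; have := rho_mono i; lia.
  case: ifP => // /andP[h1]; suff -> : nth true p (rho i + (n - i) - 2) by [].
  have ni' : i.+1 < n.
    rewrite ltnNge; apply/negP => ge; have := rho_le i.
    by rewrite (_ : n - i.+1 = 0) ?muln0; lia.
  have := up_posE p ni'; rewrite rights_before_filter // -re => q.
  have : up_pos p i.+1 \in ups p.
    by rewrite -mem_rev mem_nth // size_rev size_ups_dyck.
  have -> : up_pos p i.+1 = (rho i + (n - i) - 2).+1 by lia.
  rewrite nth_ups => h; rewrite (set_nth_default false) //.
  by rewrite ltnNge; apply: contraTN h => /(nth_default false) ->.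
have ge : 1 < rho i + (n - i) by move: t; rewrite /turn; lia.
rewrite ge /=.
have -> : nth true p (rho i + (n - i) - 2) = false; last by rewrite eqxx addn1.
have sz : rho i + (n - i) - 2 < size p.
  rewrite size_tuple mulSn; have := rho_le i; have := split_n ni; lia.
rewrite (set_nth_default false) // -nth_ups; apply/negbTE.
rewrite ups_word; last 2 first.
- exact/boundary_ups_sorted/filterP.
- exact/boundary_ups_range/filterP.
rewrite mem_rev; apply/mapP => -[x]; rewrite mem_iota /= add0n => xn.
have [xi|ix] := leqP x i.
  by have := row_length_mono (filterP A) xi; rewrite -/rho; lia.
have := row_length_mono (filterP A) ix; rewrite -/rho.
by move: t; rewrite /turn; lia.
Qed.

Definition remaining i := [seq x <- iota 1 N | b x.-1 \in left_labels i].

Lemma next_label_left i : i < n -> next_label i \in left_labels i.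
Proof.
move=> ni; rewrite left_labelsE // /next_label; case: ifP => _.
  by rewrite mem_head.
by rewrite labels_rcons mem_rcons window_end ?mem_head.
Qed.

Lemma count_next_label i : i < n ->
  count (fun x => b x.-1 == next_label i) (remaining i) = k.+1.
Proof.
move=> ni; rewrite count_filter.
rewrite (eq_count (a2 := preim predn (preim b (pred1 (next_label i))))); last first.
  by move=> x /=; case: eqP => //= ->; rewrite next_label_left.
rewrite (iotaDl 1 0) count_map.
have /labelsP[x _ <-] := next_label_left ni.
by rewrite -[RHS](label_size nc 0 x) count_map.
Qed.

(** The first k+1 remaining elements, read from the key in the prescribed
    direction, form the block of the key. *)
Lemma mem_mat_block i x : i < n ->
  (x \in mat_block n k p i (remaining i)) =
  (b x.-1 == next_label i) && (x \in iota 1 N).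
Proof.
move=> ni; rewrite /mat_block mat_keyE //.
have N0 : k * n < N by rewrite /N mulSn; lia.
have eN : e i <= k * n by rewrite leq_subr.
have nl := next_label_left ni.
have -> : (b x.-1 == next_label i) && (x \in iota 1 N) =
          (b x.-1 == next_label i) && (x \in remaining i).
  by rewrite mem_filter; case: eqP => //= ->; rewrite nl.
have cnt := count_next_label ni.
have uI : uniq (remaining i) by rewrite filter_uniq ?iota_uniq.
have sI : sorted ltn (remaining i).
  by rewrite sorted_filter ?iota_ltn_sorted //; exact: ltn_trans.
have inI y : y \in remaining i -> [/\ 0 < y, y <= N & b y.-1 \in left_labels i].
  by rewrite mem_filter mem_iota add1n ltnS => /and3P[].
have bN y : b (y + N) = b y := label_periodic nc y.
have inN y : 0 < y -> y <= N -> y \in iota 1 N by rewrite mem_iota => -> ?; lia.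
have nlE : next_label i = if turn i then b (e i) else b (N - i.+1) by [].
case: ifP nlE => t nlE; rewrite ?nlE in nl cnt *.
  have ba := first_fresh ni; have down := block_downward nc ba.
  (* List elements are positions from 1; an element that comes after the
     wrap-around is compared after adding N. *)
  rewrite (mem_take_rot (r := gtn) (P := fun x => b x.-1 == b (e i))) ?mem_rev //.
  - rewrite -sorted_pairwise ?rev_sorted //.
    by move=> u v w /= vu wv; apply: ltn_trans vu.
  - by rewrite rev_uniq.
  - by rewrite mem_filter nl inN //; lia.
  - by rewrite count_rev.
  - move=> u v; rewrite !mem_rev => /inI[u0 uN ul] /inI[v0 vN vl] /eqP bv /= au uv.
    rewrite -(bN u.-1); apply/eqP/(down _ (v.-1 + N)); rewrite ?bN //; try lia.
    by rewrite -left_labelsE.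
  - move=> u v; rewrite !mem_rev => /inI[u0 uN ul] /inI[v0 vN vl] /eqP bv /= au va.
    rewrite -(bN u.-1); apply/eqP/(down _ v.-1); rewrite ?bN //; try lia.
    by rewrite -left_labelsE.
  - move=> u v; rewrite !mem_rev => /inI[u0 uN ul] /inI[v0 vN vl] /eqP bv /= uv va.
    by apply/eqP/(down _ v.-1); rewrite -?left_labelsE //; lia.
have ba := last_fresh ni (negbT t); have aE := window_end ni.
rewrite -aE in ba; have up := block_upward nc ba.
have aN : N - i = (N - i.+1).+1 by lia.
rewrite aE -left_labelsE // in up.
have iN : n - i.+1 + rho i < N by lia.
rewrite (mem_take_rot (r := ltn) (P := fun x => b x.-1 == b (N - i.+1))) //.
- by rewrite -sorted_pairwise //; exact: ltn_trans.
- by rewrite mem_filter aN /= nl inN //; lia.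
- by rewrite aN /= eqxx.
- move=> u v /inI[u0 uN ul] /inI[v0 vN vl] /eqP bv /= au uv.
  by apply/eqP/(up _ v.-1); rewrite ?bN //; lia.
- move=> u v /inI[u0 uN ul] /inI[v0 vN vl] /eqP bv /= au va.
  by apply/eqP/(up _ (v.-1 + N)); rewrite ?bN //; lia.
move=> u v /inI[u0 uN ul] /inI[v0 vN vl] /eqP bv /= uv va.
by rewrite -(bN u.-1); apply/eqP/(up _ (v.-1 + N)); rewrite ?bN //; lia.
Qed.

Lemma remainingS i : i < n ->
  [seq x <- remaining i | x \notin mat_block n k p i (remaining i)] =
  remaining i.+1.
Proof.
move=> ni; rewrite /remaining -filter_predI; apply/eq_in_filter => x xN /=.
by rewrite mem_mat_block // xN andbT left_labelsS // andbC.
Qed.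

Lemma mat_blocks_labels m i S : i + m = n ->
  S \in mat_blocks n k p (iota i m) (remaining i) ->
  exists l, forall x, (x \in S) = (b x.-1 == l) && (x \in iota 1 N).
Proof.
elim: m i => // m IH i imn; have ni : i < n by lia.
have -> : mat_blocks n k p (iota i m.+1) (remaining i) =
    mat_block n k p i (remaining i) :: mat_blocks n k p (iota i.+1 m)
      [seq x <- remaining i | x \notin mat_block n k p i (remaining i)] by [].
rewrite (remainingS ni) inE.
case/orP => [/eqP -> |]; last by apply: IH; lia.
by exists (next_label i) => x; apply: mem_mat_block.
Qed.

Lemma bigmin_le (s : seq nat) m x : x \in s -> \big[minn/m]_(y <- s) y <= x.
Proof.
elim: s => // y s IH; rewrite inE big_cons => /orP[/eqP ->|/IH le].
  exact: geq_minl.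
by rewrite geq_min le orbT.
Qed.

Lemma mem_mat_mins x : x < N ->
  (x.+1 \in mat_mins n k p) = (b x \notin labels b 0 x).
Proof.
move=> xN; rewrite /mat_mins.
have [||] := @mat_blocksP n k p (iota 0 n) (iota 1 N).
- exact: iota_uniq.
- by rewrite !size_iota.
have remE : remaining 0 = iota 1 N.
  apply/all_filterP/allP => y; rewrite mem_iota => y1.
  by rewrite left_labels0; apply/labelsP; exists y.-1; rewrite //; lia.
have := @mat_blocks_labels n 0; rewrite remE.
set B := mat_blocks _ _ _ _ _ => lab _ Bk pB.
have inS S y : S \in B -> y \in S -> 0 < y <= N.
  move=> SB yS; have : y \in flatten B by apply/flattenP; exists S.
  by rewrite (perm_mem pB) mem_iota add1n ltnS.
have minS S : S \in B -> \big[minn/N]_(y <- S) y \in S.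
  by move=> SB; apply: min_mem => [|y /(inS _ _ SB)/andP[]//]; rewrite Bk.
apply/mapP/idP => [[S SB xE]|fresh].
  apply/labelsP => -[y /= yx by_].
  have [l lS] := lab S (add0n n) SB.
  have := minS S SB; rewrite -xE lS => /andP[/eqP bx _].
  suff /(bigmin_le N) : y.+1 \in S by rewrite -xE; lia.
  by rewrite lS /= by_ bx eqxx mem_iota; lia.
have : x.+1 \in flatten B by rewrite (perm_mem pB) mem_iota; lia.
case/flattenP => S SB xS; exists S => //; have [l lS] := lab S (add0n n) SB.
have := minS S SB; have := bigmin_le N xS; set z := \big[_/_]_(_ <- _) _.
move: xS; rewrite !lS /= => /andP[/eqP bx _] zx /andP[/eqP bz].
rewrite mem_iota => zN; apply/eqP; rewrite eqn_leq zx andbT leqNgt.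
apply: contraNN fresh => lt; apply/labelsP; exists z.-1; last by rewrite bz.
by lia.
Qed.

(** The blocks chosen by the matching map are those of [b], and a position is the
    minimum of its block exactly when its label is new. *)
Lemma Mat_labels m : m <= N -> ups_upto (Mat p) m = g 0 m.
Proof.
elim: m => [|m IH] mN; first by rewrite ups_upto0 /g (count0 gc).
rewrite ups_uptoS IH 1?ltnW // /g label_count_rcons -/g add0n addnC.
congr (nat_of_bool _ + _); rewrite -mem_mat_mins //.
by rewrite (nth_map 0) ?size_iota // nth_iota // add1n.
Qed.

End Matching.

(** * The three maps on one partition *)

Lemma slow0 n k : slow (fun=> 0 : nat) (n := n) (k := k).
Proof. by []. Qed.

Definition window_filter n k h (hc : window_count n k h) : filter_of n k :=
  Filter (slow_filter hc (@slow0 n k)).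

Lemma window_filter_at n k h (hc : window_count n k h) :
  at_times h (window_filter hc) (fun=> 0).
Proof. by move=> c; rewrite inE. Qed.

Section Assembly.
Variables (n k : nat).
Hypothesis n0 : 0 < n.
Let N := k.+1 * n.

Lemma box_fits (c : box n k) : c.1 <= n + c.2 /\ n + c.2 + k < N.
Proof.
have cn := ltn_ord c.1; have : c.2 < k * (n - c.1.+1) by case: (c) {cn}.
split; first by lia.
have : k * (n - c.1.+1) + k <= k * n by rewrite addnC -mulnS leq_mul2l; lia.
by rewrite /N mulSn; lia.
Qed.

Lemma in_at_reflect b (c : box n k) t :
  noncrossing n k b -> t <= k * n - c.2 - c.1 ->
  in_at (label_count (reflect_label N b)) c t =
  (label_count b (k * n - t - c.2) (n + c.2 - c.1) <= n - c.1.+1).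
Proof.
move=> nc tk; have [c1 c2] := box_fits c.
have NE : N = n + k * n by rewrite /N mulSn.
rewrite /in_at (reflect_count nc (q := 1)) mul1n -/N ?NE; last by lia.
by congr (label_count _ _ _ <= _); lia.
Qed.

Lemma in_at0_reflect b (c : box n k) : noncrossing n k b ->
  in_at (label_count b) c 0 =
  (label_count (reflect_label N b) (k * n - c.2) (n + c.2 - c.1) <= n - c.1.+1).
Proof.
move=> nc; have [c1 c2] := box_fits c.
have NE : N = n + k * n by rewrite /N mulSn.
rewrite (reflect_count nc (q := 1)) mul1n -/N ?NE; last by lia.
by congr (label_count _ _ _ <= _); lia.
Qed.

Lemma ev_reflect (p q : dyck n k) b : noncrossing n k b ->
  (forall m, m <= N -> ups_upto p m = label_count b 0 m) ->
  (forall m, m <= N -> ups_upto q m = label_count (reflect_label N b) 0 m) ->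
  ev p = q.
Proof.
move=> nc pb qb; apply: dyck_eq => m mN.
rewrite (ev_window (label_count_window nc) n0 pb) // qb //.
by rewrite (reflect_count nc (q := 1)) ?mul1n ?add0n.
Qed.

Lemma on_filtersE f (A : filter_of n k) :
  on_filters f (path_of_filter A) = path_of_filter (f A).
Proof. by rewrite /on_filters /= path_of_filterK. Qed.

Lemma rowmotion_iterE s (A : filter_of n k) :
  iter s (@rowmotion n k) (path_of_filter A) =
  path_of_filter (iter s (@filter_rowmotion n k) A).
Proof. by elim: s => //= s ->; exact: on_filtersE. Qed.

Lemma finv_iter (T : finType) (f : T -> T) s : injective f ->
  cancel (iter s f) (iter s (finv f)).
Proof.
by move=> fI; elim: s => // s IH x; rewrite iterSr iterS finv_f.
Qed.

(** Rowvacuation moves the window of a box by rank + 1.  The box in row i and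
    column j has rank (n-1)k - 1 - i - j, so this moves the start of its window
    from i to (n-1)k - j, and reflecting the window gives [i+k, n+j+k), its
    window at time k. *)
Lemma reflect_rowvacuation b (A A' : filter_of n k) : noncrossing n k b ->
  at_times (label_count b) A (fun=> 0) ->
  at_times (label_count (reflect_label N b)) A' (fun=> 0) ->
  filter_rowvacuation A' = iter k (@filter_rowmotion n k) A.
Proof.
move=> nc A0 A'0; have nc' := reflect_noncrossing nc.
apply: (rowmotion_iter (label_count_window nc) A0) => c.
rewrite (rowvacuation_window (label_count_window nc') A'0).
have := box_sum_lt c; have [_] := box_fits c; rewrite /N mulSn => c2 sc.
have kn : k * n = n.-1 * k + k by rewrite addnC -mulSn prednK // mulnC.
have rE : (box_rank c).+1 = n.-1 * k - (c.1 + c.2) by rewrite /box_rank; lia.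
rewrite in_at_reflect // rE /in_at; last by lia.
by congr (label_count _ _ _ <= _); lia.
Qed.

Definition dyck_filter (q : dyck n k) : filter_of n k :=
  window_filter (label_count_window
    (reflect_noncrossing (dyck_label_noncrossing q n0))).

(** A right inverse of the matching map, which is then its inverse because the
    set of paths is finite. *)
Lemma dyck_filterK : cancel (fun q => path_of_filter (dyck_filter q)) (@Mat n k).
Proof.
move=> q /=; have nc := dyck_label_noncrossing q n0.
apply: dyck_eq => m mN; rewrite -(dyck_label_count q) //.
apply: (Mat_labels n0 nc) => // c.
by rewrite window_filter_at in_at_reflect // subn0.
Qed.

End Assembly.

Theorem theorem7p16 (n k : nat) (hn : 1 <= n) (hk : 1 <= k) :
  @ev n k =1
  @Mat n k \o iter k (finv (@rowmotion n k)) \o @rowvacuation n k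
           \o finv (@Mat n k).
Proof.
move=> q /=; have MatK := canF_sym (dyck_filterK hn (k := k)).
have nc := dyck_label_noncrossing q hn; have nc' := reflect_noncrossing nc.
pose A := window_filter (label_count_window nc).
have -> : finv (@Mat n k) q = path_of_filter (dyck_filter hn q).
  by rewrite -{1}(dyck_filterK hn q) (finv_f (can_inj MatK)).
rewrite [rowvacuation _]on_filtersE.
rewrite (reflect_rowvacuation hn nc (A := A)) //; last 2 first.
- exact: window_filter_at.
- exact: window_filter_at.
rewrite -rowmotion_iterE (finv_iter _ (@rowmotion_inj n k)).
apply: (ev_reflect hn nc) => m mN; first by rewrite dyck_label_count.
apply: (Mat_labels hn nc') => // c.
by rewrite window_filter_at in_at0_reflect.
Qed.
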